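(* Fix $r$ with $0<r<1$. For $R>0$ let $\lambda_k^R$, $k=1,2,\dots$, be the $k$-th eigenvalue of the localization operator $A_{B(0,R)\setminus B(0,rR)}^{g_0}$, where $B(0,\rho)\subset\mathbb{R}^2$ is the disk of radius $\rho$ centered at the origin. Then $$\left| \lambda_k^R - \frac{1}{2}\operatorname{erfc}\left( \frac{k-\pi R^2(1-r^2)}{\sqrt{2\pi}\, R(1+r)} \right) \right| = O\left( \frac{1}{R} \right)\quad\text{as } R\to\infty,$$ uniformly in $k$; that is, there exist constants $C,R_0>0$ depending only on $r$ such that for all $R\ge R_0$ and all integers $k\ge 1$ the left-hand side is at most $C/R$.
   Context: For $(x,\omega)\in\mathbb{R}^2$ and $f \in L^2(\mathbb{R})$, the time-frequency shift is $\pi(x,\omega)f(t) = e^{2\pi i \omega t} f(t-x)$. The short-time Fourier transform with window $g \in L^2(\mathbb{R})$ is $V_g f(x,\omega) = \langle f, \pi(x,\omega) g\rangle = \int_{\mathbb{R}} f(t)\overline{g(t-x)}e^{-2\pi i \omega t}\,dt$. For a bounded measurable set $\Omega\subset\mathbb{R}^2$, the localization operator $A_\Omega^g : L^2(\mathbb{R})\to L^2(\mathbb{R})$ is $$A_\Omega^g f = \int_\Omega V_g f(x,\omega)\,\pi(x,\omega) g \,dx\,d\omega$$ (understood weakly); it is a compact, positive, self-adjoint operator. The window is the standard Gaussian $g_0(t) = 2^{1/4}e^{-\pi t^2}$. Eigenvalues are listed in non-increasing order, counted with multiplicity. $\operatorname{erfc}(x) = \frac{2}{\sqrt{\pi}}\int_x^\infty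 e^{-s^2}\,ds$. *)

(* Defs.v *)
From mathcomp Require Import all_boot all_order all_algebra complex.
Set Warnings "-notation-overridden,-notation-incompatible-prefix".
From mathcomp Require Import all_classical all_reals all_analysis.
Import Order.TTheory GRing.Theory Num.Theory.
Import numFieldNormedType.Exports.

Set Implicit Arguments.
Unset Strict Implicit.
Unset Printing Implicit Defensive.

Local Open Scope classical_set_scope.
Local Open Scope ring_scope.
Local Open Scope complex_scope.
Local Open Scope card_scope.

(** ** Complex-valued integration

    [R[i]] carries no measurable structure in the libraries, so measurability
    and integrals of complex-valued functions are taken componentwise. *)

Definition cmeasurable d (T : measurableType d) (R : realType)
    (D : set T) (f : T -> R[i]) : Prop :=
  measurable_fun D (fun t => complex.Re (f t)) /\
  measurable_fun D (fun t => complex.Im (f t)).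

(** As for [Rintegral], this is the integral only when [f] is integrable. *)
Definition cintegral d (T : measurableType d) (R : realType)
    (mu : {measure set T -> \bar R}) (D : set T) (f : T -> R[i]) : R[i] :=
  Rintegral mu D (fun t => complex.Re (f t)) +i*
  Rintegral mu D (fun t => complex.Im (f t)).

(** ** The space L^2 of the line

    Elements of L^2 are represented by functions; two representatives are
    identified when they agree almost everywhere, which is why linear
    independence and spanning below are stated almost everywhere. *)

Definition leb1 (R : realType) : {measure set (measurableTypeR R) -> \bar R} :=
  @lebesgue_measure R.

Definition leb2 (R : realType) :
    {measure set (measurableTypeR R * measurableTypeR R)%type -> \bar R} :=
  (@lebesgue_measure R \x @lebesgue_measure R)%E.

Definition L2 (R : realType) (f : R -> R[i]) : Prop :=
  cmeasurable (T := measurableTypeR R) setT f /\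
  (\int[leb1 R]_t ((complex.Re (f t) ^+ 2 + complex.Im (f t) ^+ 2)%:E) < +oo)%E.

(** Linear in the first argument. *)
Definition inner (R : realType) (f h : R -> R[i]) : R[i] :=
  cintegral (leb1 R) setT (fun t => f t * (h t)^*).

(** ** Time-frequency analysis *)

Definition cis (R : realType) (a : R) : R[i] := cos a +i* sin a.

Definition tfshift (R : realType) (z : R * R) (f : R -> R[i]) : R -> R[i] :=
  fun t => cis (2 * pi * z.2 * t) * f (t - z.1).

Definition stft (R : realType) (g f : R -> R[i]) (z : R * R) : R[i] :=
  inner f (tfshift z g).

(** [locop g Omega f h] says that [h] is (a representative of) the image of [f]
    under the localization operator with window [g] and domain [Omega], the
    vector-valued integral being understood weakly, i.e. after pairing with an
    arbitrary element of L^2. *)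
Definition locop (R : realType) (g : R -> R[i]) (Omega : set (R * R))
    (f h : R -> R[i]) : Prop :=
  [/\ L2 f, L2 h &
    forall phi : R -> R[i], L2 phi ->
      inner h phi =
      cintegral (leb2 R) Omega (fun z => stft g f z * inner (tfshift z g) phi)].

Definition gaussian (R : realType) (t : R) : R[i] :=
  (2 `^ (4^-1) * expR (- (pi * t ^+ 2)))%:C.

Definition disk (R : realType) (rho : R) : set (R * R) :=
  [set z | z.1 ^+ 2 + z.2 ^+ 2 < rho ^+ 2].

Definition erfc (R : realType) (x : R) : R :=
  2 / Num.sqrt pi * Rintegral (leb1 R) `[x, +oo[ (fun s => expR (- s ^+ 2)).

(** ** Eigenvalues with multiplicity of an operator on L^2

    An operator is given by its graph, as a relation on representatives. *)

Definition eigenspace_of (R : realType) (A : (R -> R[i]) -> (R -> R[i]) -> Prop)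
    (mu : R[i]) : set (R -> R[i]) :=
  [set f | L2 f /\ A f (fun t => mu * f t)].

Definition lincomb (R : realType) (n : nat) (c : 'I_n -> R[i])
    (b : 'I_n -> R -> R[i]) : R -> R[i] :=
  fun t => \sum_(i < n) c i * b i t.

Definition has_dim (R : realType) (E : set (R -> R[i])) (n : nat) : Prop :=
  exists b : 'I_n -> R -> R[i],
    [/\ forall i, E (b i),
        forall c : 'I_n -> R[i],
          lincomb c b = (fun=> 0) %[ae leb1 R] -> forall i, c i = 0 &
        forall f, E f ->
          exists c : 'I_n -> R[i], f = lincomb c b %[ae leb1 R]].

(** [lam 1 >= lam 2 >= ...] lists the eigenvalues of a compact positive operator
    [A], each nonzero one being repeated according to its multiplicity.  The
    value [lam 0] is irrelevant.  Since [lam] is non-increasing and nonnegative,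
    the value 0 can only occur after all the nonzero eigenvalues, as padding
    when there are finitely many of them. *)
Definition eigenvalue_listing (R : realType)
    (A : (R -> R[i]) -> (R -> R[i]) -> Prop) (lam : nat -> R) : Prop :=
  [/\ forall j k : nat, (1 <= j <= k)%N -> lam k <= lam j,
      forall k : nat, (1 <= k)%N -> 0 <= lam k &
      forall (mu : R) (n : nat), 0 < mu ->
        has_dim (eigenspace_of A mu%:C) n <->
        [set k : nat | (1 <= k)%N /\ lam k = mu] #= `I_n].

(* Main.v *)
(* In the Bargmann picture the localization operator of a radial domain is
   diagonal in the Hermite basis [h_n]: [|V h_n z|^2] is the Poisson weight
   [e^(-q) q^n / n!] with parameter [q = pi |z|^2], which under [z |-> q] carries
   planar measure to the measure of the half-line, and the off-diagonal integrals
   vanish by rotation.  Hence the eigenvalues for the annulus are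
   [mu_n = P(X_a <= n) - P(X_b <= n)] with [X_s] Poisson of parameter [s],
   [a = pi (r rho)^2] and [b = pi rho^2].  A Berry-Esseen bound (Stein's method)
   makes [mu_n] the minimum of a Gaussian ramp rising at [a] with width [sqrt a]
   and one falling at [b] with width [sqrt b], up to [O(1/rho)]; the superlevel
   sets are intervals whose length gives the decreasing rearrangement, a ramp of
   width [sqrt a + sqrt b]. *)
Require Import Defs.
From mathcomp Require Import all_boot all_order all_algebra complex.
Set Warnings "-notation-overridden,-notation-incompatible-prefix".
From mathcomp Require Import all_classical all_reals all_analysis.
From mathcomp Require Import measurable_realfun ring lra zify.
Import Order.TTheory GRing.Theory Num.Theory.
Import numFieldNormedType.Exports.
Set Implicit Arguments.
Unset Strict Implicit.
Unset Printing Implicit Defensive.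
Local Open Scope classical_set_scope.
Local Open Scope ring_scope.

(** The role of completeness of the Hermite functions is played by a property of coherent states.
    The coherent state at [z] has norm 1 and its squared Hermite coefficients are Poisson weights,
    which sum to 1; so it lies in the closed span of the [hfun n], and the short-time Fourier
    transform of an L^2 function is determined by its Hermite coefficients. An eigenfunction for a
    positive eigenvalue, stripped of its Hermite part, then has zero transform, is orthogonal to the
    original eigenfunction, and hence is null. In the plane, rotation invariance comes from shears
    and Fubini, and radial integrals from areas of disks and a subdivision argument. The minimum of
    the two ramps is justified by splitting the indices at [sqrt (a * b)]: below it the falling
    factor, above it the rising one, is within [1 / (sqrt b - sqrt a)] of 1, up to the Berry-Esseen
    error. This is where [r < 1] enters, while [r > 0] makes [sqrt a] of order [rho], so that both
    Poisson laws have Berry-Esseen error [O(1/rho)]. The listing is compared with [annulus_ev] by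
    counting the indices above a level. *)

Section derivation_rules.
Context {R : realType}.
Implicit Types (f g : R -> R) (x a b c : R).

Lemma is_derive1D f g x a b : is_derive x 1 f a -> is_derive x 1 g b ->
  is_derive x 1 (fun t => f t + g t) (a + b).
Proof. by move=> df dg; exact: (is_deriveD df dg). Qed.

Lemma is_derive1N f x a : is_derive x 1 f a -> is_derive x 1 (fun t => - f t) (- a).
Proof. by move=> df; exact: (is_deriveN df). Qed.

Lemma is_derive1B f g x a b : is_derive x 1 f a -> is_derive x 1 g b ->
  is_derive x 1 (fun t => f t - g t) (a - b).
Proof. by move=> df dg; exact: (is_deriveB df dg). Qed.

Lemma is_derive1M f g x a b : is_derive x 1 f a -> is_derive x 1 g b ->
  is_derive x 1 (fun t => f t * g t) (a * g x + f x * b).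
Proof.
move=> df dg; apply: (is_derive_eq (is_deriveM df dg)).
by rewrite /GRing.scale/= addrC (mulrC a).
Qed.

Lemma is_derive1Zl f x a c : is_derive x 1 f a ->
  is_derive x 1 (fun t => c * f t) (c * a).
Proof. by move=> df; exact: (is_deriveZ c df). Qed.

Lemma is_derive1X f x a n : is_derive x 1 f a ->
  is_derive x 1 (fun t => f t ^+ n) (n%:R * f x ^+ n.-1 * a).
Proof.
move=> df.
have -> : (fun t => f t ^+ n) = (f ^+ n) by apply/funext => t; rewrite fctE.
exact: (is_deriveX n df).
Qed.

Lemma is_derive1_expR_comp f x a : is_derive x 1 f a ->
  is_derive x 1 (fun t => expR (f t)) (a * expR (f x)).
Proof.
by move=> df; rewrite mulrC; exact: (is_derive1_comp (is_derive_expR (f x)) df).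
Qed.

Lemma is_derive1_cos_comp f x a : is_derive x 1 f a ->
  is_derive x 1 (fun t => cos (f t)) (- (a * sin (f x))).
Proof.
move=> df; rewrite mulrC -mulNr.
exact: (is_derive1_comp (is_derive_cos (f x)) df).
Qed.

Lemma is_derive1_sin_comp f x a : is_derive x 1 f a ->
  is_derive x 1 (fun t => sin (f t)) (a * cos (f x)).
Proof.
by move=> df; rewrite mulrC; exact: (is_derive1_comp (is_derive_sin (f x)) df).
Qed.

Lemma is_derive1_gauss x : is_derive x 1 (fun t => expR (- t ^+ 2)) (- (2 * x) * expR (- x ^+ 2)).
Proof.
have d := is_derive1_expR_comp (is_derive1N (is_derive1X 2 (is_derive_id x 1))).
by apply: (is_derive_eq d); rewrite expr1 mulr1.
Qed.

Lemma derivable1_continuous f x a : is_derive x 1 f a -> {for x, continuous f}.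
Proof.
by move=> df; apply/differentiable_continuous/derivable1_diffP; exact: (@ex_derive _ _ _ _ _ _ _ df).
Qed.

Lemma mean_value f (df : R -> R) a b : a < b ->
  (forall x, a <= x <= b -> is_derive x 1 f (df x)) ->
  exists2 c, a < c < b & f b - f a = df c * (b - a).
Proof.
move=> ab d; have [||c] := @MVT _ f df _ _ ab.
- by move=> x; rewrite in_itv/= => /andP[/ltW ? /ltW ?]; apply: d; apply/andP.
- by apply: derivable_within_continuous => x /[!in_itv]/= xab; exact: (@ex_derive _ _ _ _ _ _ _ (d x xab)).
by rewrite in_itv/=; exists c.
Qed.

End derivation_rules.

(** * The error function and the normal distribution *)

Section erfc.
Context {R : realType}.
Implicit Types x y : R.

Let mu := @lebesgue_measure R.

(** The varying endpoint becomes the upper end of an integral from minus infinity, the form that the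
    fundamental theorem of calculus differentiates. *)
Lemma erfcE x :
  erfc x = 2 / Num.sqrt pi *
    (Num.sqrt pi - Rintegral mu `]-oo, x] (@gauss_fun R)).
Proof.
rewrite /erfc; congr (_ * _).
have iT : mu.-integrable [set` `]-oo, +oo[ : interval R] (EFin \o gauss_fun).
  by rewrite set_itvNyy; exact: integrableT_gauss.
have := @Rintegral_itvB R gauss_fun -oo%O +oo%O x iT isT isT.
rewrite set_itvNyy {1}/Rintegral integralT_gauss /= => ->.
rewrite -/mu Rintegral_itv_obnd_cbnd//.
by apply: integrableS iT => //; exact: subset_itvr.
Qed.

Lemma is_derive_erfc x : is_derive x 1 (@erfc R) (- (2 / Num.sqrt pi * expR (- x ^+ 2))).
Proof.
have iT : mu.-integrable [set` `]-oo, (x + 1)%R]] (EFin \o gauss_fun).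
  by apply: integrableS (@integrableT_gauss R).
have [|||dI dIE] := @continuous_FTC1 R gauss_fun -oo%O x (x + 1) _ iT.
- by rewrite ltrDl.
- by rewrite ltNyr.
- exact: continuous_gauss_fun.
have -> : @erfc R = fun x => 2 / Num.sqrt pi *
    (Num.sqrt pi - Rintegral mu `]-oo, x] (@gauss_fun R)).
  by apply/funext => y; exact: erfcE.
have dI1 : is_derive x 1 (fun x => Rintegral mu `]-oo, x] (@gauss_fun R)) (gauss_fun x).
  by rewrite -dIE derive1E; exact: DeriveDef.
have d := is_derive1Zl (2 / Num.sqrt pi)
  (is_derive1B (is_derive_cst (Num.sqrt pi) x 1) dI1).
by apply: (is_derive_eq d); rewrite sub0r mulrN.
Qed.

Lemma erfc_ge0 x : 0 <= erfc x.
Proof.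
rewrite /erfc mulr_ge0 ?divr_ge0 ?sqrtr_ge0//.
by apply: Rintegral_ge0 => ? _; exact: expR_ge0.
Qed.

Lemma erfc0 : erfc (0 : R) = 1.
Proof.
rewrite /erfc /Rintegral; have := @integral0y_gauss R; rewrite /gauss_fun => ->/=.
have : Num.sqrt (pi : R) != 0 by rewrite gt_eqF// sqrtr_gt0 pi_gt0.
by move=> ?; field.
Qed.

(** [erfc y + erfc (- y)] has zero derivative, and is 2 at the origin. *)
Lemma erfcN x : erfc (- x) = 2 - erfc x.
Proof.
have := @is_derive_0_is_cst R (fun y : R => erfc y + erfc (- y)) x 0.
rewrite oppr0 erfc0 => e; suff: erfc x + erfc (- x) = 1 + 1 by lra.
apply: e => y.
have d3 := @is_derive1_comp R (@erfc R) -%R y _ _ (is_derive_erfc (- y)) (is_deriveNid _ _).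
apply: (is_derive_eq (is_derive1D (is_derive_erfc y) d3)).
by rewrite sqrrN; ring.
Qed.

Lemma erfc_nonincreasing x y : x <= y -> erfc y <= erfc x.
Proof.
rewrite le_eqVlt => /predU1P[->//|xy].
have [c _] := mean_value xy (fun z _ => is_derive_erfc z).
move=> e; rewrite -subr_le0 e mulNr oppr_le0 !mulr_ge0 ?invr_ge0 ?sqrtr_ge0 ?expR_ge0//.
by rewrite subr_ge0 ltW.
Qed.

(** For [s >= x] the integrand times [x] is at most [s * expR (- s ^+ 2)], which has an explicit
    primitive. *)
Lemma erfc_mills x : 0 < x -> x * erfc x <= expR (- x ^+ 2) / Num.sqrt pi.
Proof.
move=> x0.
have int : (\int[mu]_(s in `[x, +oo[) (s * expR (- s ^+ 2))%:E =
   (expR (- x ^+ 2) / 2)%:E)%E.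
  have d (z : R) : is_derive z 1 (fun s : R => - (expR (- s ^+ 2) / 2)) (z * expR (- z ^+ 2)).
    have d := is_derive1N (is_derive1M (is_derive1_gauss z) (is_derive_cst (2^-1 : R) z 1)).
    by apply: (is_derive_eq d); rewrite mulr0 addr0/=; field.
  rewrite (@ge0_continuous_FTC2y R _ (fun s => - (expR (- s ^+ 2) / 2)) x 0).
  - by rewrite sub0e -EFinN opprK.
  - by move=> s xs; rewrite mulr_ge0 ?expR_ge0// (le_trans _ xs)// ltW.
  - apply: continuous_subspaceT => s; apply: cvgM; first exact: cvg_id.
    exact: continuous_gauss_fun.
  - rewrite -oppr0; apply: cvgN; rewrite -[X in _ --> X](mul0r 2^-1).
    by apply: cvgM; [exact: cvg_gauss_fun|exact: cvg_cst].
  - by move=> s _; exact: (@ex_derive _ _ _ _ _ _ _ (d s)).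
  - apply: cvg_at_right_filter.

    exact: (derivable1_continuous (d x)).
  - by move=> s _; rewrite derive1E (@derive_val _ _ _ _ _ _ _ (d s)).
have le : (x%:E * \int[mu]_(s in `[x, +oo[) (expR (- s ^+ 2))%:E <= (expR (- x ^+ 2) / 2)%:E)%E.
  have mg : measurable_fun `[x, +oo[ (@gauss_fun R).
    by apply/measurable_funTS; exact: measurable_gauss_fun.
  rewrite -int -ge0_integralZl//; last 2 first.
  - exact/measurable_EFinP.
  - by rewrite lee_fin ltW.
  apply: ge0_le_integral => //.
  - by move=> ? _; rewrite -EFinM lee_fin mulr_ge0 ?expR_ge0// ltW.
  - by apply/measurable_EFinP/measurable_funM.
  - by apply/measurable_EFinP/measurable_funM.
  - move=> s /=; rewrite in_itv/= andbT => xs.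
    by rewrite -EFinM lee_fin ler_wpM2r ?expR_ge0.
rewrite /erfc -/mu.
have fin : (\int[mu]_(s in `[x, +oo[) (expR (- s ^+ 2))%:E)%E \is a fin_num.
  by apply: integrable_fin_num => //; apply: integrableS (@integrableT_gauss R).
move: le; rewrite /Rintegral -[X in (_ * X <= _)%E]fineK// -EFinM lee_fin.
set I := fine _ => le.
have s0 : 0 < Num.sqrt (pi : R) by rewrite sqrtr_gt0 pi_gt0.
rewrite [leLHS](_ : _ = (2 * (x * I)) / Num.sqrt pi); last by field; exact: lt0r_neq0.
rewrite ler_pM2r ?invr_gt0//; lra.
Qed.

End erfc.

(** * The Mills ratio and bounds on solutions of Stein's equation *)

Section stein.
Context {R : realType}.
Implicit Types (x y w c : R).

Let spi : R := Num.sqrt pi.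
Let spi_gt0 : 0 < spi. Proof. by rewrite sqrtr_gt0 pi_gt0. Qed.
Let spi_neq0 : spi != 0. Proof. exact: lt0r_neq0. Qed.

(* The normal law of variance 1/2, matched to [erfc]. *)
Definition ncdf x : R := 2^-1 * erfc (- x).

Definition npdf x : R := expR (- x ^+ 2) / spi.

Lemma npdf_gt0 x : 0 < npdf x. Proof. by rewrite divr_gt0 ?expR_gt0. Qed.

Lemma npdfN x : npdf (- x) = npdf x. Proof. by rewrite /npdf sqrrN. Qed.

Lemma ncdfN x : ncdf (- x) = 1 - ncdf x.
Proof. by rewrite /ncdf (erfcN (- x)); field. Qed.

Lemma ncdf_ge0 x : 0 <= ncdf x.
Proof. by rewrite mulr_ge0// erfc_ge0. Qed.

Lemma ncdf_le1 x : ncdf x <= 1.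
Proof. by have := ncdf_ge0 (- x); rewrite ncdfN subr_ge0. Qed.

Lemma ncdf_homo x y : x <= y -> ncdf x <= ncdf y.
Proof. by move=> xy; rewrite ler_pM2l// erfc_nonincreasing// lerN2. Qed.

Lemma is_derive_ncdf x : is_derive x 1 ncdf (npdf x).
Proof.
have d := @is_derive1_comp R (@erfc R) -%R x _ _ (is_derive_erfc (- x)) (is_deriveNid _ _).
by apply: (is_derive_eq (is_derive1Zl 2^-1 d)); rewrite /npdf -/spi sqrrN; field.
Qed.

Lemma is_derive_npdf x : is_derive x 1 npdf (- (2 * x) * npdf x).
Proof.
apply: (is_derive_eq (is_derive1M (is_derive1_gauss x) (is_derive_cst spi^-1 x 1))).
by rewrite mulr0 addr0 mulrA.
Qed.

Lemma ncdf_lipschitz x y : `|ncdf x - ncdf y| <= `|x - y|.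
Proof.
wlog xy : x y / x < y => [H|].
  have [|/H|->] := ltgtP x y; [exact: H|by rewrite distrC (distrC y)|].
  by rewrite !subrr.
rewrite distrC (distrC x).
have [c _ ->] := mean_value xy (fun z _ => is_derive_ncdf z).
rewrite normrM -[leRHS]mul1r ler_wpM2r//.
rewrite (ger0_norm (ltW (npdf_gt0 c))) ler_pdivrMr// mul1r (@le_trans _ _ 1)//.
  by rewrite -expR0 ler_expR oppr_le0 sqr_ge0.
rewrite -[1]sqrtr1 ler_wsqrtr// ltW// (lt_le_trans _ (@pi_ge2 R))//.
by rewrite ltr1n.
Qed.

(** The first summand is [1 / npdf 1]: on [[-1, 0]] the density is at least [npdf 1] while [ncdf] is
    at most 1. The second makes [1 <= K] evident, for use when [x < -1], where Mills' inequality
    gives [ncdf x <= npdf x]. *)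
Let K : R := spi * expR 1 + 1.

Lemma ncdf_left x : x <= 0 -> ncdf x <= K * npdf x.
Proof.
move=> x0; have [x1|x1] := leP (-1) x.
  apply: (le_trans (ncdf_le1 x)).
  have : 1 <= spi * expR 1 * npdf x.
    rewrite [leRHS](_ : _ = expR 1 * expR (- x ^+ 2)); last by rewrite /npdf; field.
    rewrite -expRD -{1}expR0 ler_expR; nra.
  by move=> h; rewrite /K mulrDl mul1r (le_trans h)// lerDl ltW// npdf_gt0.
have h := @erfc_mills R (- x) ltac:(lra).
rewrite sqrrN -/spi -/(npdf _) in h.
have K1 : 1 <= K by rewrite lerDr mulr_ge0 ?expR_ge0// ltW.
rewrite (@le_trans _ _ (npdf x))//; last first.
  by rewrite ler_peMl// ltW// npdf_gt0.
rewrite /ncdf (le_trans _ h)// ler_wpM2r ?erfc_ge0//; lra.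
Qed.

Lemma mills_left x : x <= 0 -> - (2 * x) * ncdf x <= npdf x.
Proof.
rewrite le_eqVlt => /predU1P[->|x0].
  by rewrite mulr0 oppr0 mul0r ltW// npdf_gt0.
have h := @erfc_mills R (- x) ltac:(lra).
rewrite sqrrN -/spi -/(npdf _) in h.
by rewrite (le_trans _ h)// /ncdf; rewrite [leLHS](_ : _ = - x * erfc (- x))//; field.
Qed.

(** As [npdf' = - 2 w npdf], dividing by [npdf] is the method of integrating factors: this is the
    solution of [F' = 2 w F + 1] that stays bounded at minus infinity. *)
Definition mills w : R := ncdf w / npdf w.

Lemma mills_ge0 w : 0 <= mills w.
Proof. by rewrite divr_ge0 ?ncdf_ge0// ltW// npdf_gt0. Qed.

Lemma is_derive_mills w : is_derive w 1 mills (2 * w * mills w + 1).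
Proof.
have n0 : npdf w != 0 by exact: lt0r_neq0 (npdf_gt0 w).
have d := is_derive1M (is_derive_ncdf w) (is_deriveV n0 (is_derive_npdf w)).
by apply: (is_derive_eq d); rewrite /GRing.scale/= /mills; field.
Qed.

(** Bounds for one branch of the Stein solution, uniform in [w0]. On [w <= 0] Mills' inequality
    suffices; for [w > 0] the ratio grows, but [1 - ncdf w0 <= ncdf (- w)] compensates and the
    estimates at [- w] apply. *)
Lemma mills_tail_bound w w0 : w <= w0 ->
  (1 - ncdf w0) * mills w <= K /\ `|2 * w * ((1 - ncdf w0) * mills w)| <= 1.
Proof.
move=> ww0; have p0 := npdf_gt0 w; have m0 := mills_ge0 w.
have c0 : 0 <= 1 - ncdf w0 by rewrite subr_ge0 ncdf_le1.
have [w_le0|w_gt0] := leP w 0.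
  have c1 : 1 - ncdf w0 <= 1 by rewrite gerBl ncdf_ge0.
  have mK : mills w <= K by rewrite ler_pdivrMr// ncdf_left.
  have mM : - (2 * w) * mills w <= 1.
    by rewrite mulrA ler_pdivrMr// mul1r mills_left.
  split; first by rewrite (le_trans _ mK)// ler_piMl.
  have q0 := mulr_ge0 c0 m0; have qm : (1 - ncdf w0) * mills w <= mills w by rewrite ler_piMl.
  by rewrite ler0_norm; nra.
have le1 : (1 - ncdf w0) <= ncdf (- w) by rewrite ncdfN lerB// ncdf_homo.
have le2 : (1 - ncdf w0) * mills w <= ncdf (- w) / npdf w.
  rewrite (@le_trans _ _ (ncdf (- w) * mills w))// ?ler_wpM2r//.
  by rewrite ler_wpM2l ?ncdf_ge0// /mills ler_piMl ?ncdf_le1// ltW// invr_gt0.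
split.
  by rewrite (le_trans le2)// ler_pdivrMr// -npdfN ncdf_left// oppr_le0 ltW.
have w2 : 0 <= 2 * w by lra.
rewrite ger0_norm; last by rewrite mulr_ge0// mulr_ge0.
rewrite (@le_trans _ _ (2 * w * (ncdf (- w) / npdf w)))//.
  by rewrite ler_wpM2l.
rewrite mulrA ler_pdivrMr// mul1r -npdfN (le_trans _ (mills_left _))//; last lra.
by rewrite mulrN opprK.
Qed.

(** A Taylor step with quadratic remainder. The equation itself controls the variation of [F']: [F'
    t - F' x = 2 t (F t - F x) + 2 (t - x) F x], and [|F t - F x| <= 2 (t - x)] because
    [|F'| <= 1 + |c| <= 2]. *)
Lemma stein_step (F : R -> R) (c C x y : R) : x < y ->
  (forall t, x <= t <= y -> [/\ is_derive t 1 F (2 * t * F t + c),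
     `|F t| <= C & `|2 * t * F t| <= 1]) -> `|c| <= 1 ->
  `|F y - F x - (y - x) * (2 * x * F x + c)|
    <= (y - x) ^+ 2 * (2 * C + 4 * (`|x| + (y - x))).
Proof.
move=> xy H c1.
have dF t : x <= t <= y -> is_derive t 1 F (2 * t * F t + c) by case/H.
have [t /andP[xt ty] ->] := mean_value xy dF.
have [|s /andP[xs st] e] := @mean_value _ F (fun t => 2 * t * F t + c) x t xt.
  by move=> s /andP[xs st]; apply: dF; rewrite xs (le_trans st)// ltW.
rewrite [X in `|X|](_ : _ = (y - x) *
  (2 * t * (F t - F x) + 2 * (t - x) * F x)); last by ring.
have [_ Fx _] := H x ltac:(by rewrite lexx ltW).
have [_ _ Fs] := H s ltac:(by rewrite !ltW// (lt_trans st)).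
have b1 : `|2 * s * F s + c| <= 2 by rewrite (le_trans (ler_normD _ _))//; lra.
have b2 : `|t| <= `|x| + (y - x).
  rewrite -[t](subrK x) addrC (le_trans (ler_normD _ _))// lerD2l ger0_norm; lra.
rewrite e normrM (ger0_norm (_ : 0 <= y - x)); last lra.
have yx0 : 0 <= y - x by lra.
rewrite expr2 -[leRHS]mulrA (ler_wpM2l yx0)//.
rewrite (le_trans (ler_normD _ _))// [leRHS]mulrDr [leLHS]addrC.
have tx0 : 0 <= t - x by lra.
apply: lerD; rewrite !normrM (ger0_norm tx0) normr_nat.
  rewrite [leLHS](_ : _ = (t - x) * (2 * `|F x|)); last ring.
  by rewrite ler_pM//; lra.
rewrite [leLHS](_ : _ = (t - x) * ((2 * `|t|) * `|2 * s * F s + c|)); last ring.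
apply: ler_pM => //; first lra.
rewrite [leRHS](_ : _ = (2 * (`|x| + (y - x))) * 2); last ring.
by apply: ler_pM => //; lra.
Qed.

End stein.

(** * Poisson tails: a Berry-Esseen bound *)

Section poisson.
Context {R : realType}.
Implicit Types (a : R) (n N : nat).

Definition pois a n : R := expR (- a) * (a ^+ n / n`!%:R).

Definition poiscdf a n : R := \sum_(j < n.+1) pois a j.

Lemma pois_ge0 a n : 0 <= a -> 0 <= pois a n.
Proof. by move=> a0; rewrite mulr_ge0 ?expR_ge0// divr_ge0// exprn_ge0. Qed.

Lemma poisS a n : n.+1%:R * pois a n.+1 = a * pois a n.
Proof.
rewrite /pois factS natrM exprS; field.
by rewrite nat1r !pnatr_eq0 -lt0n fact_gt0.
Qed.

Lemma pois_sum_cvg a : \sum_(j < N) pois a j @[N --> \oo] --> (1 : R).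
Proof.
have h : expR (- a) * series (exp_coeff a) N @[N --> \oo] --> (1 : R).
  rewrite -(expR0) -(addNr a) expRD; apply: cvgMl_tmp.
  exact: is_cvg_series_exp_coeff.
have -> // : (fun N => \sum_(j < N) pois a j) =
  (fun N => expR (- a) * series (exp_coeff a) N).
apply/funext => N; rewrite /series/= big_mkord mulr_sumr.
by apply: eq_bigr.
Qed.

Lemma pois_cvg0 a : pois a n @[n --> \oo] --> (0 : R).
Proof.
rewrite -(mulr0 (expR (- a))); apply: cvgMl_tmp.
exact: cvg_exp_coeff.
Qed.

Lemma pois_sum_le1 a N : 0 <= a -> \sum_(j < N) pois a j <= 1.
Proof.
move=> a0; apply: (cvgr_to_ge (@pois_sum_cvg a)).
near=> M.
rewrite -!(big_mkord xpredT (pois a)) (@big_cat_nat _ _ _ N 0 M)//=; last first.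
  by near: M; exact: nbhs_infty_ge.
by rewrite lerDl; apply: sumr_ge0 => i _; exact: pois_ge0.
Unshelve. all: by end_near. Qed.

(** The derivatives of consecutive weights telescope. This Poisson-Gamma duality later turns areas
    into differences of Poisson tails. *)
Lemma is_derive_poiscdf a n : is_derive a 1 (poiscdf ^~ n) (- pois a n).
Proof.
elim: n => [|n IH].
  have -> : poiscdf ^~ 0 = fun a : R => expR (- a).
    by apply/funext => x; rewrite /poiscdf big_ord1 /pois expr0 divr1 mulr1.
  apply: (is_derive_eq (is_derive1_expR_comp (is_deriveNid a 1))).
  by rewrite /pois expr0 divr1 mulr1 mulN1r.
have -> : poiscdf ^~ n.+1 = fun a : R => poiscdf a n + pois a n.+1.
  by apply/funext => x; rewrite /poiscdf big_ord_recr.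
have d1 := is_derive1_expR_comp (is_deriveNid a 1).
have d2 := is_derive1M (is_derive1X n.+1 (is_derive_id a 1))
  (is_derive_cst (n.+1`!%:R^-1 : R) a 1).
apply: (is_derive_eq (is_derive1D IH (is_derive1M d1 d2))).
rewrite /pois/= mulr0 addr0 factS natrM; field.
by rewrite nat1r !pnatr_eq0 -lt0n fact_gt0.
Qed.

(** The Chen-Stein identity [E [X g(X)] = a E [g(X + 1)]] of a Poisson variable, cut off at [N]: by
    [poisS] the summand is [G j - G j.+1] with [G j = j * pois a j * g j]. Working with finite sums
    costs a boundary term at [N]. *)
Lemma pois_telescope a N (g : nat -> R) :
  \sum_(j < N) pois a j * ((j%:R - a) * g j - a * (g j.+1 - g j)) =
  - (N%:R * pois a N * g N).
Proof.
elim: N => [|N IH]; first by rewrite big_ord0 !mul0r oppr0.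
by rewrite big_ord_recr IH /= poisS; ring.
Qed.

(** The identity is applied to [g j = j - a]; since [a <= N] the boundary term has the favourable
    sign. *)
Lemma pois_variance a N : 0 <= a -> a <= N%:R ->
  \sum_(j < N) pois a j * (j%:R - a) ^+ 2 <= a.
Proof.
move=> a0 aN; have := pois_telescope a N (fun j => j%:R - a).
rewrite (eq_bigr (fun j : 'I_N => pois a j * (j%:R - a) ^+ 2 - a * pois a j)); last first.
  by move=> j _; rewrite -natr1; ring.
move=> h; rewrite -[leLHS](subrK (a * \sum_(j < N) pois a j)).
rewrite {1}mulr_sumr -sumrB h -[leRHS]add0r lerD//.
  by rewrite oppr_le0 mulr_ge0 ?subr_ge0// mulr_ge0// pois_ge0.
by rewrite ler_piMr// pois_sum_le1.
Qed.

Lemma pois_absdev a N : 0 < a -> a <= N%:R ->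
  \sum_(j < N) pois a j * `|j%:R - a| <= Num.sqrt a.
Proof.
move=> a0 aN; set s := Num.sqrt a.
have s0 : 0 < s by rewrite sqrtr_gt0.
have sa : s ^+ 2 = a by rewrite sqr_sqrtr// ltW.
(* The inequality [2 s |x| <= x ^ 2 + s ^ 2], with [s = sqrt a] balancing the two terms, stands in
   for Cauchy-Schwarz. *)
have h : \sum_(j < N) pois a j * `|j%:R - a| <=
    \sum_(j < N) ((2 * s)^-1 * (pois a j * (j%:R - a) ^+ 2) + s / 2 * pois a j).
  apply: ler_sum => j _.
  rewrite -(ler_pM2l (_ : 0 < 2 * s)); last by rewrite mulr_gt0.
  rewrite [leRHS](_ : _ = pois a j * (`|j%:R - a| ^+ 2 + s ^+ 2)); last first.
    by rewrite real_normK ?num_real//; field; exact: lt0r_neq0.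
  rewrite mulrCA ler_wpM2l ?(pois_ge0 _ (ltW a0))//.
  rewrite -subr_ge0 (_ : _ - _ = (`|j%:R - a| - s) ^+ 2); last ring.
  exact: sqr_ge0.
rewrite (le_trans h)// big_split/= -[X in X + _]mulr_sumr -[X in _ + X]mulr_sumr.
have v := pois_variance (ltW a0) aN; have p := pois_sum_le1 N (ltW a0).
rewrite -(ler_pM2l (_ : 0 < 2 * s)); last by rewrite mulr_gt0.
set V := \sum_(i < N) _ in v *; set P := \sum_(i < N) _ in p *.
rewrite [leLHS](_ : _ = V + a * P); last by rewrite -sa; field; exact: lt0r_neq0.
have -> : 2 * s * s = a + a by rewrite -sa; ring.
by rewrite lerD// ler_piMr// ltW.
Qed.

(* Test [pois_telescope] against the indicator of [j <= n]. *)
Lemma pois_le_invsqrt a n : 0 < a -> pois a n <= (Num.sqrt a)^-1.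
Proof.
move=> a0; set s := Num.sqrt a.
have s0 : 0 < s by rewrite sqrtr_gt0.
have sa : s ^+ 2 = a by rewrite sqr_sqrtr// ltW.
pose N := maxn n.+1 (Num.truncn a).+1.
have aN : a <= N%:R.
  by rewrite (le_trans (ltW (truncnS_gt a)))// ler_nat leq_maxr.
have nN : (n < N)%N by rewrite leq_maxl.
pose g j : R := (j <= n)%:R.
have := pois_telescope a N g.
have -> : g N = 0 by rewrite /g leqNgt nN.
rewrite mulr0 oppr0.
under eq_bigr do rewrite mulrBr.
rewrite sumrB => /eqP; rewrite subr_eq0 => /eqP h.
have e : \sum_(j < N) pois a j * (a * (g j.+1 - g j)) = - (a * pois a n).
  rewrite (bigD1 (Ordinal nN))//= big1 ?addr0; last first.
    move=> j /eqP jn; rewrite /g.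
    have -> : (j < n)%N = (j <= n)%N.
      by rewrite ltn_neqAle; case: eqP => // e; case: jn; apply: val_inj.
    by rewrite subrr !mulr0.
  by rewrite /g ltnn leqnn /=; ring.
have : a * pois a n <= s.
  rewrite -[_ * _]opprK -e -h (le_trans _ (pois_absdev a0 aN))//.
  rewrite -sumrN; apply: ler_sum => j _; rewrite -mulrN.
  rewrite ler_wpM2l ?(pois_ge0 _ (ltW a0))// -mulNr (le_trans (ler_norm _))//.
  by rewrite normrM normrN ler_piMr// /g; case: leq; rewrite ?normr1 ?normr0.
rewrite -sa expr2 -mulrA -ler_pdivlMl// mulVf ?lt0r_neq0// => h2.
by rewrite -[leRHS]mulr1 ler_pdivlMl.
Qed.

End poisson.

(** * Stein's method on the grid of standardised integers *)

Section berry_esseen.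
Context {R : realType}.
Implicit Types (a : R) (n N : nat).

Let K : R := Num.sqrt pi * expR 1 + 1.
Let K_ge0 : 0 <= K. Proof. by rewrite addr_ge0// mulr_ge0 ?expR_ge0 ?sqrtr_ge0. Qed.

(** Standardised to variance 1/2, the variance of [ncdf], hence [2 * a]. The integers become a grid
    of mesh [dl a], and [a = 1 / (2 * dl a ^ 2)]. *)
Let v a j : R := (j%:R - a) / Num.sqrt (2 * a).

Let dl a : R := (Num.sqrt (2 * a))^-1.

(* Solves Stein's equation [F' - 2 t F = (t <= v a n) - ncdf (v a n)]. *)
Let F a n t : R := if t <= v a n then (1 - ncdf (v a n)) * mills t
  else ncdf (v a n) * mills (- t).

Let F_le a n t : `|F a n t| <= K.
Proof.
rewrite /F; case: (leP t (v a n)) => [tn|tn].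
  have [+ _] := mills_tail_bound tn.
  by rewrite ger0_norm// mulr_ge0 ?mills_ge0// subr_ge0 ncdf_le1.
have tn' : - t <= - v a n by rewrite lerN2 ltW.
have [+ _] := mills_tail_bound tn'; rewrite ncdfN subKr.
by rewrite ger0_norm// mulr_ge0 ?mills_ge0// ncdf_ge0.
Qed.

(** Each grid step stays in one branch of [F]: left for [j < n], right for [j >= n], the branches
    agreeing at the node [v a n]. At [j = n] the indicator is still 1 whereas the right branch
    solves the equation with 0 in its place; this discrepancy is the last term. *)
Let F_step a n j : 0 < a ->
  `|F a n (v a j.+1) - F a n (v a j) -
     dl a * (2 * v a j * F a n (v a j) + ((j <= n)%:R - ncdf (v a n)))|
  <= (dl a) ^+ 2 * (2 * K + 4 * (`|v a j| + dl a)) + dl a * (j == n)%:R.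
Proof.
move=> a0; set d := dl a.
have d0 : 0 < d by rewrite invr_gt0 sqrtr_gt0 mulr_gt0.
have vS i : v a i.+1 = v a i + d by rewrite /v -/(dl a) -/d -natr1; ring.
have vle i k : (v a i <= v a k) = (i <= k)%N.
  by rewrite /v ler_pM2r ?lerD2r ?ler_nat// /d.
have vlt : v a j < v a j.+1 by rewrite vS ltrDl.
have d_eq : v a j.+1 - v a j = d by rewrite vS addrAC subrr add0r.
have [jn|nj] := ltnP j n.
  rewrite (ltnW jn) (ltn_eqF jn) mulr0 addr0 /F !vle jn (ltnW jn).
  have := @stein_step R (fun t => (1 - ncdf (v a n)) * mills t) (1 - ncdf (v a n)) K _ _ vlt.
  rewrite d_eq; apply => [t /andP[_ tj]|].
    have tn : t <= v a n by rewrite (le_trans tj)// vle.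
    have [m1 m2] := mills_tail_bound tn; split; last by [].
    - apply: (is_derive_eq (is_derive1Zl _ (is_derive_mills t))); ring.
    - by rewrite ger0_norm// mulr_ge0 ?mills_ge0// subr_ge0 ncdf_le1.
  by rewrite ger0_norm ?gerBl ?subr_ge0 ?ncdf_le1 ?ncdf_ge0.
have -> : F a n (v a j.+1) = ncdf (v a n) * mills (- v a j.+1).
  by rewrite /F vle leqNgt ltnS nj.
have -> : F a n (v a j) = ncdf (v a n) * mills (- v a j).
  rewrite /F vle; case: leqP => // jn.
  have -> : j = n by apply/eqP; rewrite eqn_leq jn.
  by rewrite /mills ncdfN npdfN; ring.
have -> : (j <= n)%:R = (j == n)%:R :> R by rewrite eqn_leq nj andbT.
set G := fun t : R => ncdf (v a n) * mills (- t).
have h := @stein_step R G (- ncdf (v a n)) K _ _ vlt.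
rewrite d_eq -![ncdf _ * mills _]/(G _) in h *.
rewrite [X in `|X|](_ : _ = (G (v a j.+1) - G (v a j) -
  d * (2 * v a j * G (v a j) - ncdf (v a n))) - d * (j == n)%:R); last by ring.
rewrite (le_trans (ler_normB _ _))// lerD//; last first.
  by rewrite ger0_norm// mulr_ge0// ltW.
apply: h => [t /andP[jt _]|]; last by rewrite normrN ger0_norm ?ncdf_le1 ?ncdf_ge0.
have tn : - t <= - v a n by rewrite lerN2 (le_trans _ jt)// vle.
have [m1 m2] := mills_tail_bound tn; rewrite ncdfN subKr in m1 m2.
split.
- have dm := @is_derive1_comp R mills -%R t _ _ (is_derive_mills (- t)) (is_deriveNid _ _).
  by apply: (is_derive_eq (is_derive1Zl _ dm)); rewrite /G; ring.
- by rewrite ger0_norm// mulr_ge0 ?mills_ge0// ncdf_ge0.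
- by move: m2; rewrite mulrN mulNr normrN.
Qed.

Let be_finite a n N : 0 < a -> a <= N.+1%:R -> (n < N)%N ->
  `|poiscdf a n - ncdf (v a n) * \sum_(j < N.+1) pois a j| <=
  dl a * (2 * K + 4 + 4 * dl a) + (Num.sqrt a)^-1 + (dl a)^-1 * K * pois a N.
Proof.
move=> a0 aN nN; set d := dl a.
have d0 : 0 < d by rewrite invr_gt0 sqrtr_gt0 mulr_gt0.
have ad : a = 2^-1 * d ^- 2.
  by rewrite exprVn invrK sqr_sqrtr ?mulr_ge0// ?ltW//; field.
have vd j : j%:R - a = v a j / d by rewrite /v -/(dl a) -/d mulfK// lt0r_neq0.
pose r j := F a n (v a j.+1) - F a n (v a j) -
     d * (2 * v a j * F a n (v a j) + ((j <= n)%:R - ncdf (v a n))).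
have cdfE : poiscdf a n = \sum_(j < N.+1) pois a j * (j <= n)%:R.
  rewrite /poiscdf (big_ord_widen N.+1 (pois a)) 1?ltnW// big_mkcond/=.
  by apply: eq_bigr => j _; rewrite ltnS; case: leq; rewrite ?mulr1 ?mulr0.
(* Stein's equation at the nodes is inserted in [pois_telescope]: with [a = 1 / (2 d ^ 2)] the
   difference operator of the Poisson law is, up to [r j], the differential operator of the normal
   law. *)
have e : d * (poiscdf a n - ncdf (v a n) * \sum_(j < N.+1) pois a j) =
    - (d ^+ 2 * 2) * (- (N.+1%:R * pois a N.+1 * F a n (v a N.+1)))
    - \sum_(j < N.+1) pois a j * r j.
  rewrite -(pois_telescope a N.+1 (fun j => F a n (v a j))) cdfE !mulr_sumr -!sumrB.
  rewrite mulr_sumr; apply: eq_bigr => j _.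
  have alg (p b f0 f1 w c : R) : d * (p * b - c * p) =
      - (d ^+ 2 * 2) * (p * (w / d * f0 - 2^-1 / d ^+ 2 * (f1 - f0)))
      - p * (f1 - f0 - d * (2 * w * f0 + (b - c))).
    by field; exact: lt0r_neq0.
  by rewrite vd (alg _ _ (F a n (v a j)) (F a n (v a j.+1)) (v a j)) -ad.
rewrite -(ler_pM2l d0) -{1}(ger0_norm (ltW d0)) -normrM e.
have -> : - (d ^+ 2 * 2) * - (N.+1%:R * pois a N.+1 * F a n (v a N.+1)) =
    (d ^+ 2 * 2 * a) * pois a N * F a n (v a N.+1) by rewrite poisS; ring.
have -> : d ^+ 2 * 2 * a = 1 by rewrite ad; field; exact: lt0r_neq0.
rewrite mul1r (le_trans (ler_normB _ _))// [leLHS]addrC [leRHS]mulrDr.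
apply: lerD; last first.
  rewrite [leRHS](_ : _ = pois a N * K); last by field; exact: lt0r_neq0.
  by rewrite normrM (ger0_norm (pois_ge0 _ (ltW a0))) ler_wpM2l ?(pois_ge0 _ (ltW a0)).
rewrite (le_trans (ler_norm_sum _ _ _))//.
(* The [|v a j|] part of the remainder is rewritten as [d * |j - a|], whose mean is at most
   [sqrt a <= 1 / d]; the kink contributes [pois a n]. *)
apply: (@le_trans _ _ (\sum_(j < N.+1) (d ^+ 2 * (2 * K + 4 * d) * pois a j +
   d ^+ 3 * 4 * (pois a j * `|j%:R - a|) + d * (pois a j * (j == n :> nat)%:R)))).
  apply: ler_sum => j _; rewrite normrM (ger0_norm (pois_ge0 _ (ltW a0))).
  rewrite (le_trans (ler_wpM2l (pois_ge0 _ (ltW a0)) (F_step n j a0)))//.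
  have -> : `|j%:R - a| = `|v a j| * d^-1.
    by rewrite vd normrM [`|d^-1|]ger0_norm// invr_ge0 ltW.
  rewrite -/d.
  by rewrite le_eqVlt; apply/orP; left; apply/eqP; field; exact: lt0r_neq0.
rewrite 2!big_split/= -[X in X + _ + _]mulr_sumr -[X in _ + X + _]mulr_sumr -[X in _ + X]mulr_sumr.
have -> : \sum_(j < N.+1) pois a j * (j == n :> nat)%:R = pois a n.
  rewrite (bigD1 (Ordinal (ltnW nN : (n < N.+1)%N)))//= eqxx mulr1 big1 ?addr0//.
  by move=> j /eqP jn; case: eqP => [e'|]; rewrite ?mulr0//; case: jn; exact: val_inj.
rewrite [leRHS]mulrDr; apply: lerD; last by rewrite ler_pM2l// pois_le_invsqrt.
rewrite [leRHS](_ : _ = d ^+ 2 * (2 * K + 4 * d) + d ^+ 3 * 4 * d^-1); last first.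
  by field; exact: lt0r_neq0.
apply: lerD.
  by rewrite ler_piMr ?pois_sum_le1 ?ltW// mulr_gt0 ?exprn_gt0// ltr_wpDl ?mulr_ge0 ?mulr_gt0.
apply: ler_wpM2l; first by rewrite mulr_ge0// exprn_ge0// ltW.
rewrite (le_trans (pois_absdev a0 aN))// /d invrK ler_wsqrtr//; lra.
Qed.

Lemma pois_berry_esseen : exists2 C : R, 0 < C & forall a n, 1 <= a ->
  `|poiscdf a n - ncdf ((n%:R - a) / Num.sqrt (2 * a))| <= C / Num.sqrt a.
Proof.
(* This is [(2 K + 4 + 4 d) + 1] with [d <= 1]; the final 1 comes from the kink, and the boundary
   term vanishes as [N] grows. *)
exists (2 * K + 9); first by rewrite ltr_wpDl// mulr_ge0.
move=> a n a1; rewrite -/(v a n).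
have a0 : 0 < a by lra.
set d := dl a.
have d0 : 0 < d by rewrite invr_gt0 sqrtr_gt0 mulr_gt0.
set s := Num.sqrt a.
have s1 : 1 <= s by rewrite -[1]sqrtr1 ler_wsqrtr.
have s0 : 0 < s by lra.
have ds : d <= s^-1 by rewrite lef_pV2 ?posrE ?ler_wsqrtr ?sqrtr_gt0//; lra.
have d1 : d <= 1 by rewrite (le_trans ds)// invf_le1.
apply: (@le_trans _ _ (d * (2 * K + 4 + 4 * d) + s^-1)); last first.
  rewrite (_ : (2 * K + 9) / s = s^-1 * (2 * K + 4 + 4 * 1) + s^-1); last ring.
  have k0 := K_ge0.
  by rewrite lerD2r; apply: ler_pM; lra.
have l1 : `|poiscdf a n - ncdf (v a n) * \sum_(j < N.+1) pois a j| @[N --> \oo]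
    --> `|poiscdf a n - ncdf (v a n)|.
  apply: cvg_norm; apply: cvgB; first exact: cvg_cst.
  rewrite -[X in _ --> X]mulr1.
  apply: cvgMl_tmp; rewrite (_ : (fun N => _) = (fun N => \sum_(j < N + 1) pois a j)).
    by rewrite (cvg_shiftn 1 (fun N => \sum_(j < N) pois a j)); exact: pois_sum_cvg.
  by apply/funext => N; rewrite addn1.
have l2 : d * (2 * K + 4 + 4 * d) + s^-1 + d^-1 * K * pois a N @[N --> \oo]
    --> d * (2 * K + 4 + 4 * d) + s^-1.
  rewrite -[X in _ --> X]addr0 -[X in _ --> _ + X](mulr0 (d^-1 * K)).
  apply: cvgD; first exact: cvg_cst.
  by apply: cvgMl_tmp; exact: pois_cvg0.
apply: (ler_cvg_to l1 l2); near=> N; apply: be_finite => //.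
  rewrite (le_trans (ltW (truncnS_gt a)))// ler_nat ltnS.
  by near: N; exact: nbhs_infty_ge.
by near: N; exact: nbhs_infty_gt.
Unshelve. all: by end_near. Qed.

End berry_esseen.

(** * Two listings with equal multiplicities *)

Lemma card_eq_choice (I : Type) (P : I -> Prop) (A B : I -> set nat) :
  (forall i, P i -> (A i #= B i)%card) ->
  exists F : I -> nat -> nat, forall i, P i -> set_bij (A i) (B i) (F i).
Proof.
move=> AB; have H i : exists f, P i -> set_bij (A i) (B i) f.
  have [Pi|nPi] := pselect (P i); last by exists id.
  by have /card_set_bijP[f fP] := AB i Pi; exists f.
by have [F FP] := choice H; exists F.
Qed.

Section rearrangement.
Context {R : realType}.
Variables mu lam : nat -> R.
Hypothesis lam_homo : forall j k : nat, (1 <= j <= k)%N -> lam k <= lam j.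
Hypothesis same_mult : forall m : R, 0 < m ->
  ([set n | mu n = m] #= [set k : nat | (1 <= k)%N /\ lam k = m])%card.

(** The bijections between level sets carry [1, ..., k] to distinct indices: equal images lie at the
    same level, and within a level the map is injective. Bijections are given at positive levels,
    hence [0 <= t]. *)
Lemma rearranged_above (t : R) (k : nat) : 0 <= t -> (1 <= k)%N -> t < lam k ->
  exists s : seq nat, [/\ uniq s, size s = k & {in s, forall n, t < mu n}].
Proof.
move=> t0 k1 tk.
have same_mult' (m : R) : 0 < m ->
    ([set k : nat | (1 <= k)%N /\ lam k = m] #= [set n | mu n = m])%card.
  by move=> m0; rewrite card_eq_sym; exact: same_mult.
have [F FP] := card_eq_choice same_mult'.
have lamt j : j \in iota 1 k -> t < lam j.
  rewrite mem_iota add1n ltnS => /andP[j1 jk].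
  by rewrite (lt_le_trans tk)// lam_homo// j1.
have muF j : j \in iota 1 k -> mu (F (lam j) j) = lam j.
  move=> jk; have [f _ _] := FP _ (le_lt_trans t0 (lamt _ jk)).
  by apply: f; move: jk; rewrite mem_iota => /andP[].
exists [seq F (lam j) j | j <- iota 1 k]; split.
- rewrite map_inj_in_uniq ?iota_uniq// => i j ik jk e.
  have lij : lam i = lam j by rewrite -muF// e muF.
  have [_ inj _] := FP _ (le_lt_trans t0 (lamt _ ik)).
  apply: inj; rewrite ?inE/=; last by rewrite e lij.
    by move: ik; rewrite mem_iota => /andP[].
  by move: jk; rewrite mem_iota => /andP[].
- by rewrite size_map size_iota.
- by move=> n /mapP[j jk ->]; rewrite muF// lamt.
Qed.

(** The converse transport: distinct [n] with [mu n] above [lam k] go to distinct positions, all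
    before [k] by monotonicity of [lam]. *)
Lemma rearranged_below (k : nat) (s : seq nat) : (1 <= k)%N -> 0 <= lam k -> uniq s ->
  {in s, forall n, lam k < mu n} -> (size s < k)%N.
Proof.
move=> k1 lk us sk; have [F FP] := card_eq_choice same_mult.
have fP n : n \in s -> (1 <= F (mu n) n)%N /\ lam (F (mu n) n) = mu n.
  by move=> /sk /(le_lt_trans lk) /FP[f _ _]; exact: f.
rewrite -(size_map (fun n => F (mu n) n)) -(prednK k1) ltnS.
rewrite -(size_iota 1 k.-1); apply: uniq_leq_size.
  rewrite map_inj_in_uniq// => i j i_s j_s e.
  have mij : mu i = mu j by rewrite -(fP i i_s).2 e (fP j j_s).2.
  have [_ inj _] := FP _ (le_lt_trans lk (sk _ i_s)).
  by apply: inj; rewrite ?inE//= e mij.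
move=> _ /mapP[n ns ->]; have [n1 nl] := fP n ns.
rewrite mem_iota n1/= add1n prednK// ltnNge; apply/negP => kn.
by have := lam_homo (introT andP (conj k1 kn)); rewrite leNgt nl sk.
Qed.

End rearrangement.

(** * Counting natural numbers in an interval *)

Section counting.
Context {R : realType}.
Implicit Types (x y : R) (s : seq nat).

(** Nonemptiness of [s] excludes the intervals with [y < x - 1], where the bound is negative. *)
Lemma size_between x y s : uniq s -> (0 < size s)%N ->
  {in s, forall n, x < n%:R < y} -> (size s)%:R <= y - x + 1.
Proof.
move=> us s0 h.
have [n ns] : exists n, n \in s by case: s s0 {us h} => // n s _; exists n; rewrite mem_head.
have y0 : 0 <= y.
  by have /andP[_ ny] := h n ns; rewrite (le_trans _ (ltW ny)).
(* For negative [x] the truncation is 0, and its successor would skip the index 0. *)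
pose p := if x < 0 then 0%N else (Num.truncn x).+1.
pose q := (Num.truncn y).+1.
have xp : x <= p%:R.
  by rewrite /p; case: ltP => [/ltW//|_]; rewrite ltW// truncnS_gt.
have qy : q%:R <= y + 1 by rewrite -natr1 lerD2r; rewrite truncn_le.
have pn m : m \in s -> (p <= m < q)%N.
  move=> /h /andP[xm my]; apply/andP; split.
    rewrite /p; case: ltP => // x0.
    by rewrite truncn_lt_nat.
  by rewrite -(ltr_nat R) (lt_trans my)// truncnS_gt.
have pq : (p <= q)%N by have /andP[/leq_trans h1 /ltnW/h1] := pn n ns.
have : (size s <= q - p)%N.
  rewrite -(size_iota p (q - p)); apply: uniq_leq_size => // m /pn.
  by rewrite mem_iota subnKC.
rewrite -(ler_nat R) natrB// => /le_trans; apply; lra.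
Qed.

(** The margin 2 pays for rounding the two endpoints. *)
Lemma naturals_between x y k : 0 <= x -> k%:R <= y - x - 2 ->
  exists s, [/\ uniq s, (k <= size s)%N & {in s, forall n, x < n%:R < y}].
Proof.
move=> x0 kxy; pose p := (Num.truncn x).+1; pose q := Num.truncn y.
have k0 : (0 : R) <= k%:R by [].
have px : p%:R <= x + 1 by rewrite -natr1 lerD2r truncn_le.
have xp : x < p%:R := truncnS_gt x.
have qy : q%:R <= y by rewrite truncn_le; lra.
have yq : y < q%:R + 1 by rewrite natr1 truncnS_gt.
exists (iota p (q - p)); split; first exact: iota_uniq.
  by rewrite size_iota leq_subRL -?(ler_nat R) ?natrD; lra.
move=> n; rewrite mem_iota => /andP[pn nq].
have pq : (p <= q)%N.
  by rewrite leqNgt; apply/negP => /ltnW qp; move: nq; rewrite (eqP qp) addn0 ltnNge pn.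
rewrite subnKC// in nq; rewrite (lt_le_trans xp) ?ler_nat//=.
by rewrite (lt_le_trans _ qy)// ltr_nat.
Qed.

End counting.

(** * Decreasing rearrangement of the eigenvalues *)

Section annulus_estimate.
Context {R : realType}.
Variables (C a b : R) (lam : nat -> R).
Hypotheses (C0 : 0 < C) (a1 : 1 <= a) (ab : a < b).
Hypothesis berry_esseen : forall (x : R) n, 1 <= x ->
  `|poiscdf x n - ncdf ((n%:R - x) / Num.sqrt (2 * x))| <= C / Num.sqrt x.
Hypothesis lam_homo : forall j k : nat, (1 <= j <= k)%N -> lam k <= lam j.
Hypothesis lam_ge0 : forall k : nat, (1 <= k)%N -> 0 <= lam k.
Hypothesis same_mult : forall m : R, 0 < m ->
  ([set n | poiscdf a n - poiscdf b n = m] #= [set k : nat | (1 <= k)%N /\ lam k = m])%card.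

Let s : R := Num.sqrt a.
Let t : R := Num.sqrt b.
Let c2 : R := Num.sqrt 2.
Let s1 : 1 <= s. Proof. by rewrite -[1]sqrtr1 ler_wsqrtr. Qed.
Let st : s < t. Proof.
have b0 : 0 < b by have := a1; have := ab => *; lra.
by rewrite /s /t ltr_sqrt.
Qed.
Let c1 : 1 <= c2. Proof. by rewrite -[1]sqrtr1 ler_wsqrtr// ler1n. Qed.
Let sE : Num.sqrt (2 * a) = c2 * s. Proof. by rewrite sqrtrM. Qed.
Let tE : Num.sqrt (2 * b) = c2 * t. Proof. by rewrite sqrtrM. Qed.
Let b_ge1 : 1 <= b := le_trans a1 (ltW ab).
Let aE : a = s ^+ 2. Proof. by rewrite sqr_sqrtr// (le_trans _ a1). Qed.
Let bE : b = t ^+ 2. Proof. by rewrite sqr_sqrtr// (le_trans _ b_ge1). Qed.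
Let c2E : c2 ^+ 2 = 2. Proof. by rewrite sqr_sqrtr. Qed.

Let c2_le2 : c2 <= 2.
Proof. by have := c1; rewrite -c2E expr2 => hc; rewrite ler_peMr//; lra. Qed.

Let E := C / s.

Let be_a n : `|poiscdf a n - ncdf ((n%:R - a) / (c2 * s))| <= E.
Proof. by rewrite -sE; exact: berry_esseen. Qed.

(** Stated for the upper tail, so that both ramps are [ncdf] of a scaled distance into the interval
    from [a] to [b]. *)
Let be_b n : `|(1 - poiscdf b n) - ncdf ((b - n%:R) / (c2 * t))| <= E.
Proof.
have -> : (b - n%:R) / (c2 * t) = - ((n%:R - b) / (c2 * t)) by rewrite -mulNr opprB.
rewrite ncdfN -tE distrC [X in `|X|](_ : _ = poiscdf b n -
  ncdf ((n%:R - b) / Num.sqrt (2 * b))); last by ring.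
rewrite (le_trans (berry_esseen n b_ge1))//.
have := s1; have := st => ? ?.
by rewrite /E ler_pM2l// lef_pV2 ?posrE -/t; lra.
Qed.

Let cdf_ge0 x n : 0 <= x -> 0 <= poiscdf x n :> R.
Proof. by move=> x0; apply: sumr_ge0 => i _; exact: pois_ge0. Qed.

Let cdf_le1 x n : 0 <= x -> poiscdf x n <= 1 :> R.
Proof. exact: pois_sum_le1. Qed.

(** Decay of order [1 / x] is enough: the lemma is used at distances proportional to [sqrt a] and to
    [sqrt b - sqrt a], both of order [rho] in the application. *)
Lemma ncdf_tail (x : R) : 0 < x -> ncdf (- x) <= (2 * x)^-1.
Proof.
move=> x0; have /= := erfc_mills x0; rewrite /ncdf opprK => h.
rewrite invfM ler_pM2l// -(ler_pM2l x0) mulfV ?lt0r_neq0// (le_trans h)//.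
have spi : 0 < Num.sqrt (pi : R) by rewrite sqrtr_gt0 pi_gt0.
rewrite ler_pdivrMr// mul1r (@le_trans _ _ 1)//.
  by rewrite -expR0 ler_expR oppr_le0 sqr_ge0.
rewrite -[1]sqrtr1 ler_wsqrtr// (le_trans _ (@pi_ge2 R))//.
by rewrite ler1n.
Qed.

(** The set where both ramps exceed [ncdf z] is the interval from [a + c2 s z] to [b - c2 t z]; its
    length is [k] exactly at [z = y k], and one unit of length is worth [h] in [z]. *)
Let y k : R := (b - a - k%:R) / (c2 * (s + t)).
Let h : R := (c2 * (s + t))^-1.
Let h0 : 0 < h.
Proof. by have := s1; have := st; have := c1 => ? ? ?; rewrite invr_gt0 mulr_gt0//; lra. Qed.

(** Otherwise [k] eigenvalues exceed the level. Each is at most either factor, so their indices lie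
    in an interval of length [k - 2], which holds at most [k - 1] integers. *)
Let lam_upper k : (1 <= k)%N -> lam k <= ncdf (y k + 2 * h) + E.
Proof.
move=> k1; have := s1; have := st; have := c1 => hc hst hs.
have C0' := C0; have a1' := a1; have ab' := ab; have h0' := h0.
have aE' := aE; have bE' := bE; have c2E' := c2E.
rewrite leNgt; apply/negP => lt.
have E0 : 0 <= E by rewrite divr_ge0//; lra.
have [|u [uu su uP]] := rearranged_above lam_homo same_mult _ k1 lt.
  by rewrite addr_ge0// ncdf_ge0.
have : {in u, forall n, a + c2 * s * (y k + 2 * h) < n%:R < b - c2 * t * (y k + 2 * h)}.
  move=> n /uP; set z := y k + _ => zn; apply/andP; split; rewrite ltNge; apply/negP => nz.
    have : poiscdf a n <= ncdf z + E.
      have := be_a n; rewrite ler_norml => /andP[_]; rewrite lerBlDl => /le_trans; apply.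
      rewrite lerD2r ncdf_homo// ler_pdivrMr ?mulr_gt0//; lra.
    have := @cdf_ge0 b n ltac:(lra); lra.
  have : 1 - poiscdf b n <= ncdf z + E.
    have := be_b n; rewrite ler_norml => /andP[_]; rewrite lerBlDl => /le_trans; apply.
    rewrite lerD2r ncdf_homo// ler_pdivrMr ?mulr_gt0//; lra.
  have := @cdf_le1 a n ltac:(lra); lra.
move=> /(size_between uu); rewrite su => /(_ k1).
have -> : b - c2 * t * (y k + 2 * h) - (a + c2 * s * (y k + 2 * h)) + 1 = k%:R - 1.
  by rewrite /y -/h /h; field; apply/andP; split; apply: lt0r_neq0; lra.
by lra.
Qed.

(** The shift [3 h] gives an interval of length [k + 3], which contains [k] integers even after the
    loss of 2 in [naturals_between]. If the bound failed, all their eigenvalues would exceed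
    [lam k], against [rearranged_below]. *)
Let lam_lower k : (1 <= k)%N ->
  ncdf (y k - 3 * h) - (2 * E + (t - s)^-1 + s^-1) <= lam k.
Proof.
move=> k1; have := s1; have := st; have := c1 => hc hst hs.
have C0' := C0; have a1' := a1; have ab' := ab; have h0' := h0.
have aE' := aE; have bE' := bE; have c2E' := c2E.
have E0 : 0 <= E by rewrite divr_ge0//; lra.
have ts0 : 0 < (t - s)^-1 by rewrite invr_gt0; lra.
have s0 : 0 < s^-1 by rewrite invr_gt0; lra.
set z := y k - _.
have tail x : t - s <= 2 * x -> ncdf (- x) <= (t - s)^-1.
  move=> xts; have x0 : 0 < x by lra.
  rewrite (le_trans (ncdf_tail x0))// lef_pV2 ?posrE; lra.
(* An interval starting below 0 has integers that are no indices, so counting fails; but then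
   [z < - s / 2] and [ncdf z] is itself below the error term [1 / s]. *)
have [az|az] := ltP (a + c2 * s * z) 0.
  have : ncdf z <= s^-1.
    apply: (@le_trans _ _ (ncdf (- (s / 2)))).
      apply: ncdf_homo; have sp : 0 < s by lra.
      have w : s + c2 * z < 0 by rewrite -(pmulr_rlt0 _ sp); lra.
      have c20 : 0 < c2 by lra.
      have z0 : z < 0 by rewrite -(pmulr_rlt0 _ c20); lra.
      have := ler_wnM2r (ltW z0) c2_le2; lra.
    rewrite (le_trans (ncdf_tail _))//; first lra.
    by rewrite lef_pV2 ?posrE; lra.
  by have := lam_ge0 k1; lra.
rewrite leNgt; apply/negP => lt.
have [|u [uu ku uP]] := @naturals_between R _ (b - c2 * t * z) k az.
  rewrite le_eqVlt; apply/orP; right; rewrite -subr_gt0.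
  rewrite [ltRHS](_ : _ = 1); first by [].
  by rewrite /z /y -/h /h; field; apply/andP; split; apply: lt0r_neq0; lra.
have := rearranged_below lam_homo same_mult k1 (lam_ge0 k1) uu.
rewrite ltnNge ku => H; suff : false by []; apply: H => n /uP /andP[zn nz].
apply: (lt_le_trans lt).
have A : ncdf z - E <= poiscdf a n.
  have := be_a n; rewrite distrC ler_norml => /andP[_]; rewrite lerBlDr -lerBlDl => h1.
  rewrite (le_trans _ h1)// lerD2r ncdf_homo// ler_pdivlMr ?mulr_gt0//; lra.
have B : ncdf z - E <= 1 - poiscdf b n.
  have := be_b n; rewrite distrC ler_norml => /andP[_]; rewrite lerBlDr -lerBlDl => h1.
  rewrite (le_trans _ h1)// lerD2r ncdf_homo// ler_pdivlMr ?mulr_gt0//; lra.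
(* At [n = s t], the geometric mean of [a] and [b], both ramps have the argument [(t - s) / c2]. On
   either side one factor is therefore within [1 / (t - s) + E] of 1, and the eigenvalue, the sum of
   the factors minus 1, equals the other factor up to that error. *)
pose x := (t - s) / c2.
have xE : c2 * x = t - s by rewrite mulrC divfK// lt0r_neq0//; lra.
have tx : 1 - (t - s)^-1 <= ncdf x.
  have x0 : 0 < x by rewrite divr_gt0//; lra.
  have x2 : t - s <= 2 * x by rewrite -xE ler_pM2r// c2_le2.
  by have := tail x x2; rewrite ncdfN; lra.
have [nm|nm] := leP n%:R (s * t).
  have : 1 - (t - s)^-1 - E <= 1 - poiscdf b n.
    have := be_b n; rewrite distrC ler_norml => /andP[_]; rewrite lerBlDr -lerBlDl => h1.
    rewrite (le_trans _ h1)// lerD2r (le_trans tx)// ncdf_homo// ler_pdivlMr ?mulr_gt0//;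
      rewrite ?mulrA ?[x * _]mulrC ?xE; lra.
  by lra.
have : 1 - (t - s)^-1 - E <= poiscdf a n.
  have := be_a n; rewrite distrC ler_norml => /andP[_]; rewrite lerBlDr -lerBlDl => h1.
  rewrite (le_trans _ h1)// lerD2r (le_trans tx)// ncdf_homo// ler_pdivlMr ?mulr_gt0//;
    rewrite ?mulrA ?[x * _]mulrC ?xE; lra.
by lra.
Qed.

(** [ncdf] is 1-Lipschitz, so the shifts by [2 h] and [3 h] cost at most [3 / (2 s)]. *)
Lemma annulus_estimate k : (1 <= k)%N ->
  `|lam k - ncdf ((b - a - k%:R) / (c2 * (s + t)))| <= (3 * C + 4) / s + (t - s)^-1.
Proof.
move=> k1; have := s1; have := st; have := c1 => hc hst hs.
have C0' := C0; have a1' := a1; have ab' := ab; have h0' := h0.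
have aE' := aE; have bE' := bE; have c2E' := c2E.
have u := lam_upper k1; have l := lam_lower k1; rewrite -/(y k).
have hs' : h <= (2 * s)^-1.
  rewrite lef_pV2 ?posrE ?mulr_gt0//; try lra.
  by apply: (@le_trans _ _ (s + t)); [|rewrite ler_peMl//]; lra.
have E0 : 0 < E by rewrite divr_gt0//; lra.
have hE : (2 * s)^-1 = 2^-1 * s^-1 by rewrite invfM.
have s0 : 0 < s^-1 by rewrite invr_gt0; lra.
have ts0 : 0 < (t - s)^-1 by rewrite invr_gt0; lra.
have -> : (3 * C + 4) / s = 3 * E + 4 * s^-1 by rewrite /E; ring.
have := ncdf_lipschitz (y k + 2 * h) (y k); rewrite [X in _ <= `|X|](_ : _ = 2 * h); last ring.
have := ncdf_lipschitz (y k) (y k - 3 * h); rewrite [X in _ <= `|X|](_ : _ = 3 * h); last ring.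
have h2 : 0 < 2 * h by rewrite mulr_gt0.
have h3 : 0 < 3 * h by rewrite mulr_gt0.
rewrite (gtr0_norm h2) (gtr0_norm h3) !ler_norml => /andP[_ ?] /andP[_ ?].
by apply/andP; split; lra.
Qed.

End annulus_estimate.

(** * Complex-valued square-integrable functions *)

Local Open Scope complex_scope.
Local Open Scope ring_scope.

Section complex_parts.
Context {R : realType}.
Implicit Types z w : R[i].

Definition sqc z : R := complex.Re z ^+ 2 + complex.Im z ^+ 2.

Lemma cReD z w : complex.Re (z + w) = complex.Re z + complex.Re w.
Proof. by case: z; case: w. Qed.

Lemma cImD z w : complex.Im (z + w) = complex.Im z + complex.Im w.
Proof. by case: z; case: w. Qed.

Lemma cReM z w :
  complex.Re (z * w) = complex.Re z * complex.Re w - complex.Im z * complex.Im w.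
Proof. by case: z; case: w. Qed.

Lemma cImM z w :
  complex.Im (z * w) = complex.Re z * complex.Im w + complex.Im z * complex.Re w.
Proof. by case: z; case: w. Qed.

Lemma cReJ z : complex.Re z^* = complex.Re z. Proof. by case: z. Qed.

Lemma cImJ z : complex.Im z^* = - complex.Im z. Proof. by case: z. Qed.

Lemma complexP z w :
  complex.Re z = complex.Re w -> complex.Im z = complex.Im w -> z = w.
Proof. by case: z => a b; case: w => c d /= -> ->. Qed.

Lemma sqc_ge0 z : 0 <= sqc z. Proof. by rewrite addr_ge0 ?sqr_ge0. Qed.

Lemma sqcM z w : sqc (z * w) = sqc z * sqc w.
Proof. by rewrite /sqc cReM cImM; ring. Qed.

Lemma sqcJ z : sqc z^* = sqc z. Proof. by rewrite /sqc cReJ cImJ sqrrN. Qed.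

Lemma sqcX z n : sqc (z ^+ n) = sqc z ^+ n.
Proof.
elim: n => [|n IH]; first by rewrite !expr0 /sqc/= expr1n expr0n addr0.
by rewrite !exprS sqcM IH.
Qed.

Lemma conj_real (a : R) : (a%:C : R[i])^* = a%:C.
Proof. by apply: complexP; rewrite ?(cReJ, cImJ)//= oppr0. Qed.

Lemma mulcJ z : z * z^* = (sqc z)%:C.
Proof. by apply: complexP; rewrite ?cReM ?cImM cReJ cImJ /sqc/=; ring. Qed.

Lemma sqc0 z : sqc z = 0 -> z = 0.
Proof.
move=> /eqP; rewrite paddr_eq0 ?sqr_ge0// !sqrf_eq0 => /andP[/eqP r /eqP i].
exact: complexP.
Qed.

Lemma ler_Re_sqc z (e : R) : 0 <= e -> sqc z <= e ^+ 2 -> `|complex.Re z| <= e.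
Proof.
move=> e0 h; rewrite -(@ler_pXn2r _ 2) ?nnegrE// real_normK ?num_real//.
by rewrite (le_trans _ h)// lerDl sqr_ge0.
Qed.

Lemma ler_Im_sqc z (e : R) : 0 <= e -> sqc z <= e ^+ 2 -> `|complex.Im z| <= e.
Proof.
move=> e0 h; rewrite -(@ler_pXn2r _ 2) ?nnegrE// real_normK ?num_real//.
by rewrite (le_trans _ h)// lerDr sqr_ge0.
Qed.

End complex_parts.

Section complex_integral.
Context d (T : measurableType d) (R : realType).
Variable mu : {measure set T -> \bar R}.
Variable D : set T.
Hypothesis mD : measurable D.
Implicit Types f g : T -> R[i].

Definition cintegrable f :=
  mu.-integrable D (EFin \o (fun t => complex.Re (f t))) /\
  mu.-integrable D (EFin \o (fun t => complex.Im (f t))).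

Let integrable_ext (f g : T -> R) :
  mu.-integrable D (EFin \o f) -> f =1 g -> mu.-integrable D (EFin \o g).
Proof. by move=> + /funext <-. Qed.

Lemma integrableDr (f g : T -> R) : mu.-integrable D (EFin \o f) ->
  mu.-integrable D (EFin \o g) -> mu.-integrable D (EFin \o (fun t => f t + g t)).
Proof. exact: integrableD. Qed.

Lemma integrableBr (f g : T -> R) : mu.-integrable D (EFin \o f) ->
  mu.-integrable D (EFin \o g) -> mu.-integrable D (EFin \o (fun t => f t - g t)).
Proof. exact: integrableB. Qed.

Lemma integrableZlr (k : R) (f : T -> R) : mu.-integrable D (EFin \o f) ->
  mu.-integrable D (EFin \o (fun t => k * f t)).
Proof. exact: integrableZl. Qed.

Lemma cintegrableD f g : cintegrable f -> cintegrable g ->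
  cintegrable (fun t => f t + g t).
Proof.
move=> [fr fi] [gr gi]; split.
  by apply: integrable_ext (integrableDr fr gr) _ => t; rewrite cReD.
by apply: integrable_ext (integrableDr fi gi) _ => t; rewrite cImD.
Qed.

Lemma cintegrableZ (c : R[i]) f : cintegrable f -> cintegrable (fun t => c * f t).
Proof.
move=> [fr fi]; split.
  by apply: integrable_ext (integrableBr (integrableZlr (complex.Re c) fr)
    (integrableZlr (complex.Im c) fi)) _ => t; rewrite cReM.
by apply: integrable_ext (integrableDr (integrableZlr (complex.Re c) fi)
    (integrableZlr (complex.Im c) fr)) _ => t; rewrite cImM.
Qed.

Lemma cintegrable0 : cintegrable (fun=> 0).
Proof. by split; exact: integrable0. Qed.

Lemma cintegrable_sum n (f : 'I_n -> T -> R[i]) :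
  (forall i, cintegrable (f i)) -> cintegrable (fun t => \sum_(i < n) f i t).
Proof.
elim: n f => [|n IH] f h.
  rewrite (_ : (fun t => _) = fun=> 0); first exact: cintegrable0.
  by apply/funext => t; rewrite big_ord0.
rewrite (_ : (fun t => _) = fun t => \sum_(i < n) f (widen_ord (leqnSn n) i) t + f ord_max t).
  by apply: cintegrableD => //; apply: (IH (fun i => f (widen_ord (leqnSn n) i))).
by apply/funext => t; rewrite big_ord_recr.
Qed.

Lemma cintegralD f g : cintegrable f -> cintegrable g ->
  cintegral mu D (fun t => f t + g t) = cintegral mu D f + cintegral mu D g.
Proof.
move=> [fr fi] [gr gi]; apply: complexP; rewrite ?cReD ?cImD /=.
  by rewrite -RintegralD//; apply: eq_Rintegral => t _; rewrite cReD.
by rewrite -RintegralD//; apply: eq_Rintegral => t _; rewrite cImD.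
Qed.

Lemma cintegralZ (c : R[i]) f : cintegrable f ->
  cintegral mu D (fun t => c * f t) = c * cintegral mu D f.
Proof.
move=> [fr fi]; apply: complexP; rewrite ?cReM ?cImM /=.
  rewrite -!RintegralZl// -RintegralB//; try exact: integrableZlr.
  by apply: eq_Rintegral => t _; rewrite cReM.
rewrite -!RintegralZl// -RintegralD//; try exact: integrableZlr.
by apply: eq_Rintegral => t _; rewrite cImM.
Qed.

Lemma cintegral0 : cintegral mu D (fun=> 0) = 0.
Proof. by rewrite /cintegral/= Rintegral_cst// mul0r. Qed.

Lemma cintegral_sum n (f : 'I_n -> T -> R[i]) : (forall i, cintegrable (f i)) ->
  cintegral mu D (fun t => \sum_(i < n) f i t) = \sum_(i < n) cintegral mu D (f i).
Proof.
elim: n f => [|n IH] f h.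
  rewrite big_ord0 -[RHS]cintegral0; congr cintegral.
  by apply/funext => t; rewrite big_ord0.
rewrite (_ : (fun t => _) = fun t => \sum_(i < n) f (widen_ord (leqnSn n) i) t + f ord_max t).
  by rewrite cintegralD// ?big_ord_recr/= ?IH//; apply: cintegrable_sum.
by apply/funext => t; rewrite big_ord_recr.
Qed.

Lemma cintegralJ f : cintegrable f ->
  cintegral mu D (fun t => (f t)^*) = (cintegral mu D f)^*.
Proof.
move=> [fr fi]; apply: complexP; rewrite ?cReJ ?cImJ /=.
  by apply: eq_Rintegral => t _; rewrite cReJ.
by rewrite -mulN1r -RintegralZl//; apply: eq_Rintegral => t _; rewrite cImJ mulN1r.
Qed.

Lemma eq_cintegral f g : {in D, f =1 g} -> cintegral mu D f = cintegral mu D g.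
Proof. by move=> fg; congr (_ +i* _); apply: eq_Rintegral => t tD; rewrite fg. Qed.

End complex_integral.

Section L2_theory.
Context {R : realType}.
Implicit Types (f g h : R -> R[i]) (c : R[i]).

Local Notation T := (measurableTypeR R).

Lemma L2_sq_integrable f : L2 f -> (leb1 R).-integrable setT (EFin \o (fun t => sqc (f t))).
Proof.
move=> [[mr mi] fin]; apply/integrableP; split.
  by apply/measurable_EFinP; apply: measurable_funD; exact: measurable_funX.
apply: le_lt_trans fin; rewrite le_eqVlt; apply/orP; left; apply/eqP.
by apply: eq_integral => t _; rewrite /= ger0_norm// sqc_ge0.
Qed.

Lemma L2_of_bound f (B : R -> R) : cmeasurable (T := T) setT f ->
  (leb1 R).-integrable setT (EFin \o B) -> (forall t, sqc (f t) <= B t) -> L2 f.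
Proof.
move=> mf iB fB; split => //.
have [mr mi] := mf.
have mS : measurable_fun [set: T] (fun t => sqc (f t)).
  by apply: measurable_funD; exact: measurable_funX.
have : (leb1 R).-integrable setT (EFin \o (fun t => sqc (f t))).
  apply: le_integrable iB => //; first exact/measurable_EFinP.
  move=> t _; rewrite /= lee_fin ger0_norm ?sqc_ge0//.
  by rewrite (le_trans (fB t))// ler_norm.
exact: integrable_lty.
Qed.

(** Each part of the product is dominated by the sum of the two squared moduli. *)
Lemma L2_mulJ_integrable f g : L2 f -> L2 g ->
  cintegrable (leb1 R) setT (fun t => f t * (g t)^*).
Proof.
move=> f2 g2; have iF := L2_sq_integrable f2; have iG := L2_sq_integrable g2.
have iFG := integrableDr measurableT iF iG.
have [[fr fi] _] := f2; have [[gr gi] _] := g2.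
have bnd (a b a' b' : R) : `|a * b + a' * b'| <= (a ^+ 2 + a' ^+ 2) + (b ^+ 2 + b' ^+ 2).
  rewrite ler_norml; apply/andP; split.
    rewrite -subr_ge0 (_ : _ - _ = 2^-1 * ((a + b) ^+ 2 + (a' + b') ^+ 2 +
      a ^+ 2 + b ^+ 2 + a' ^+ 2 + b' ^+ 2)); last by field.
    by rewrite mulr_ge0// !addr_ge0// ?sqr_ge0.
  rewrite -subr_ge0 (_ : _ - _ = 2^-1 * ((a - b) ^+ 2 + (a' - b') ^+ 2 +
    a ^+ 2 + b ^+ 2 + a' ^+ 2 + b' ^+ 2)); last by field.
  by rewrite mulr_ge0// !addr_ge0// ?sqr_ge0.
split; apply: le_integrable iFG => //.
- apply/measurable_EFinP.
  rewrite (_ : (fun t => _) = fun t => complex.Re (f t) * complex.Re (g t) +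
    complex.Im (f t) * complex.Im (g t)).
    by apply: measurable_funD; exact: measurable_funM.
  by apply/funext => t; rewrite cReM cReJ cImJ mulrN opprK.
- move=> t _; rewrite /= lee_fin cReM cReJ cImJ mulrN opprK (le_trans (bnd _ _ _ _))//.
  exact: ler_norm.
- apply/measurable_EFinP.
  rewrite (_ : (fun t => _) = fun t => complex.Im (f t) * complex.Re (g t) -
    complex.Re (f t) * complex.Im (g t)).
    by apply: measurable_funB; exact: measurable_funM.
  by apply/funext => t; rewrite cImM cReJ cImJ mulrN addrC.
- move=> t _; rewrite /= lee_fin cImM cReJ cImJ mulrN -mulNr addrC.
  rewrite (le_trans (bnd _ _ _ _))// sqrrN [X in X + _ <= _]addrC (le_trans _ (ler_norm _))//.
Qed.

Lemma L2D f g : L2 f -> L2 g -> L2 (fun t => f t + g t).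
Proof.
move=> f2 g2; have iF := L2_sq_integrable f2; have iG := L2_sq_integrable g2.
have [[fr fi] _] := f2; have [[gr gi] _] := g2.
apply: (L2_of_bound _ (integrableZlr measurableT 2 (integrableDr measurableT iF iG))).
  split.
    rewrite (_ : (fun t => _) = fun t => complex.Re (f t) + complex.Re (g t)).
      exact: measurable_funD.
    by apply/funext => t; rewrite cReD.
  rewrite (_ : (fun t => _) = fun t => complex.Im (f t) + complex.Im (g t)).
    exact: measurable_funD.
  by apply/funext => t; rewrite cImD.
move=> t; rewrite /sqc cReD cImD -subr_ge0.
rewrite (_ : _ - _ = (complex.Re (f t) - complex.Re (g t)) ^+ 2 +
  (complex.Im (f t) - complex.Im (g t)) ^+ 2); last by ring.
by rewrite addr_ge0 ?sqr_ge0.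
Qed.

Lemma L2Z c f : L2 f -> L2 (fun t => c * f t).
Proof.
move=> f2; have iF := L2_sq_integrable f2; have [[fr fi] _] := f2.
apply: (L2_of_bound _ (integrableZlr measurableT (sqc c) iF)); last by move=> t; rewrite sqcM.
split.
  rewrite (_ : (fun t => _) = fun t => complex.Re c * complex.Re (f t) -
    complex.Im c * complex.Im (f t)).
    by apply: measurable_funB; exact: measurable_funM.
  by apply/funext => t; rewrite cReM.
rewrite (_ : (fun t => _) = fun t => complex.Re c * complex.Im (f t) +
  complex.Im c * complex.Re (f t)).
  by apply: measurable_funD; exact: measurable_funM.
by apply/funext => t; rewrite cImM.
Qed.

Lemma L2_0 : L2 (fun=> 0 : R[i]).
Proof.
apply: (@L2_of_bound _ (fun=> 0)); first by split; exact: measurable_cst.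
  exact: integrable0.
by move=> t; rewrite /sqc/= expr0n addr0.
Qed.

Lemma L2_lincomb n (c : 'I_n -> R[i]) (b : 'I_n -> R -> R[i]) :
  (forall i, L2 (b i)) -> L2 (lincomb c b).
Proof.
rewrite /lincomb; elim: n c b => [|n IH] c b h.
  rewrite (_ : (fun t => _) = fun=> 0); first exact: L2_0.
  by apply/funext => t; rewrite big_ord0.
rewrite (_ : (fun t => _) = fun t => \sum_(i < n) c (widen_ord (leqnSn n) i) *
    b (widen_ord (leqnSn n) i) t + c ord_max * b ord_max t).
  apply: L2D; last exact: L2Z.
  exact: (IH (fun i => c (widen_ord (leqnSn n) i)) (fun i => b (widen_ord (leqnSn n) i))).
by apply/funext => t; rewrite big_ord_recr.
Qed.

Lemma innerDl f g h : L2 f -> L2 g -> L2 h ->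
  inner (fun t => f t + g t) h = inner f h + inner g h.
Proof.
move=> f2 g2 h2; rewrite /inner -cintegralD//; try exact: L2_mulJ_integrable.
by congr cintegral; apply/funext => t; rewrite mulrDl.
Qed.

Lemma innerZl c f h : L2 f -> L2 h -> inner (fun t => c * f t) h = c * inner f h.
Proof.
move=> f2 h2; rewrite /inner -cintegralZ//; last exact: L2_mulJ_integrable.
by congr cintegral; apply/funext => t; rewrite mulrA.
Qed.

Lemma innerC f g : L2 f -> L2 g -> inner g f = (inner f g)^*.
Proof.
move=> f2 g2; rewrite /inner -cintegralJ//; last exact: L2_mulJ_integrable.
congr cintegral; apply/funext => t.
by apply: complexP; rewrite ?(cReJ, cImJ, cReM, cImM); ring.
Qed.

Lemma innerDr f g h : L2 f -> L2 g -> L2 h ->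
  inner h (fun t => f t + g t) = inner h f + inner h g.
Proof.
move=> f2 g2 h2; rewrite /inner -cintegralD//; try exact: L2_mulJ_integrable.
by congr cintegral; apply/funext => t; rewrite rmorphD mulrDr.
Qed.

Lemma innerZr c f h : L2 f -> L2 h -> inner h (fun t => c * f t) = c^* * inner h f.
Proof.
move=> f2 h2; rewrite /inner -cintegralZ//; last exact: L2_mulJ_integrable.
by congr cintegral; apply/funext => t; rewrite rmorphM mulrCA.
Qed.

Lemma inner_lincombl n (c : 'I_n -> R[i]) (b : 'I_n -> R -> R[i]) h :
  (forall i, L2 (b i)) -> L2 h ->
  inner (lincomb c b) h = \sum_(i < n) c i * inner (b i) h.
Proof.
move=> b2 h2; rewrite /inner.
rewrite (_ : (fun t => _) = fun t => \sum_(i < n) c i * (b i t * (h t)^*)).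
  rewrite cintegral_sum//.
    by apply: eq_bigr => i _; rewrite cintegralZ//; exact: L2_mulJ_integrable.
  by move=> i; apply: cintegrableZ => //; exact: L2_mulJ_integrable.
by apply/funext => t; rewrite /lincomb mulr_suml; apply: eq_bigr => i _; rewrite mulrA.
Qed.

Definition normsq f : R := Rintegral (leb1 R) setT (fun t => sqc (f t)).

Lemma normsq_ge0 f : 0 <= normsq f.
Proof. by apply: Rintegral_ge0 => t _; exact: sqc_ge0. Qed.

Lemma inner_self f : inner f f = (normsq f)%:C.
Proof.
apply: complexP => /=; first by apply: eq_Rintegral => t _; rewrite mulcJ.
rewrite (_ : (fun t => _) = fun=> 0); first by rewrite Rintegral_cst// mul0r.
by apply/funext => t; rewrite mulcJ.
Qed.

Lemma normsq_eq0 f : L2 f -> normsq f = 0 -> f = (fun=> 0) %[ae leb1 R].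
Proof.
move=> f2 f0; have iF := L2_sq_integrable f2.
have : (\int[leb1 R]_t `|(sqc (f t))%:E| = 0)%E.
  transitivity (\int[leb1 R]_t (sqc (f t))%:E)%E.
    by apply: eq_integral => t _; rewrite gee0_abs// lee_fin sqc_ge0.
  rewrite -[LHS]fineK; last exact: integrable_fin_num.
  by rewrite -[fine _]/(normsq f) f0.
move=> /(proj1 (ae_eq_integral_abs _ measurableT (measurable_int _ iF))).
by apply: filterS => t /(_ I)/= [/sqc0].
Qed.

(** The squared norm of [f - s w g] is expanded for real [s]; the choice [s = 1 / G] minimises
    it. *)
Lemma cauchy_schwarz f g : L2 f -> L2 g -> sqc (inner f g) <= normsq f * normsq g.
Proof.
move=> f2 g2; set w := inner f g; set F := normsq f; set G := normsq g.
have key (s : R) : 0 <= F - 2 * s * sqc w + s ^+ 2 * sqc w * G.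
  have u2 : L2 (fun t => - (s%:C * w) * g t) by exact: L2Z.
  have := normsq_ge0 (fun t => f t + - (s%:C * w) * g t).
  suff -> : normsq (fun t => f t + - (s%:C * w) * g t) =
     F - 2 * s * sqc w + s ^+ 2 * sqc w * G by [].
  have fu2 := L2D f2 u2.
  have e : inner f f = F%:C by exact: inner_self.
  have e' : inner g g = G%:C by exact: inner_self.
  have := inner_self (fun t => f t + - (s%:C * w) * g t).
  rewrite innerDl// innerZl// (innerC fu2 f2) (innerC fu2 g2) !innerDl// !innerZl//.
  rewrite e e' (innerC f2 g2) -/w => /(congr1 (@complex.Re _)) /= <-.
  by rewrite /w /sqc /inner /cintegral /=; ring.
have G0 : 0 <= G := normsq_ge0 g.
have [G_gt0|] := ltP 0 G; last first.
  rewrite le_eqVlt ltNge G0 orbF => /eqP G_eq0.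
  rewrite G_eq0 mulr0; have W0 := sqc_ge0 w.
  rewrite leNgt; apply/negP => W1.
  (* With [G = 0] the expression is affine in [s]; this value of [s] makes it [-1]. *)
  have := key ((F + 1) / (2 * sqc w)); rewrite G_eq0 mulr0 addr0.
  rewrite (_ : 2 * _ * _ = F + 1); last by field; exact: lt0r_neq0.
  by lra.
have := key G^-1.
rewrite (_ : _ + _ = F - sqc w / G); last by field; exact: lt0r_neq0.
by rewrite subr_ge0 ler_pdivrMr.
Qed.

Lemma inner_ae0 f g : L2 f -> L2 g -> f = (fun=> 0) %[ae leb1 R] -> inner f g = 0.
Proof.
move=> f2 g2 f0; apply: sqc0; apply/eqP; rewrite eq_le sqc_ge0 andbT.
rewrite (le_trans (cauchy_schwarz f2 g2))// (_ : normsq f = 0) ?mul0r//.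
have iF := L2_sq_integrable f2.
have : (\int[leb1 R]_t (sqc (f t))%:E = \int[leb1 R]_t 0)%E.
  apply: ae_eq_integral => //; first exact: measurable_int iF.
  move: f0; rewrite /ae_eq /almost_everywhere.
  move=> [N [mN N0 sub]]; exists N; split => // t /= nt; apply: sub => /= ft.
  by apply: nt => _; rewrite (ft I) /sqc/= expr0n addr0.
by rewrite integral0 /normsq /Rintegral => ->.
Qed.

End L2_theory.

(** * Hermite functions and their short-time Fourier transforms *)

Section gaussian_bounds.
Context {R : realType}.
Implicit Types (f F q : R -> R) (p : {poly R}).
Local Notation T := (measurableTypeR R).

Lemma integrable_gauss_bound f (C : R) : measurable_fun [set: T] f ->
  (forall t, `|f t| <= C * expR (- t ^+ 2)) -> (leb1 R).-integrable setT (EFin \o f).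
Proof.
move=> mf fC.
have iG : (leb1 R).-integrable setT (EFin \o (fun t => C * expR (- t ^+ 2))).
  by apply: integrableZlr => //; exact: integrableT_gauss.
apply: le_integrable iG => //; first exact/measurable_EFinP.
by move=> t _; rewrite /= lee_fin (le_trans (fC t))// ler_norm.
Qed.

Lemma cvg_gauss_bound F (C : R) (u : nat -> R) :
  (forall t, `|F t| <= C * expR (- t ^+ 2)) -> (forall n, `|u n| = n%:R) ->
  F (u n) @[n --> \oo] --> (0 : R).
Proof.
move=> FC un; apply: norm_cvg0.
apply: (@squeeze_cvgr _ _ _ _ (fun=> 0) (fun n : nat => C * expR (- n%:R ^+ 2))).
- apply: nearW => n; rewrite normr_ge0/= (le_trans (FC _))//.
  by rewrite -(real_normK (num_real (u n))) un.
- exact: cvg_cst.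
- rewrite -(mulr0 C); apply: cvgMl_tmp.
  exact: (cvg_comp _ _ (@cvgr_idn R) (@cvg_gauss_fun R)).
Qed.

(** The fundamental theorem on [[-n, n]] followed by dominated convergence; the boundary values
    vanish by Gaussian decay. Integration by parts for overlaps rests on it. *)
Lemma integral_derivative_eq0 F f (C : R) : (forall t : R, is_derive t 1 F (f t)) ->
  continuous f -> (forall t, `|f t| <= C * expR (- t ^+ 2)) ->
  (forall t, `|F t| <= C * expR (- t ^+ 2)) ->
  Rintegral (leb1 R) setT f = 0.
Proof.
move=> dF cf fC FC.
have mf : measurable_fun [set: T] f by exact: continuous_measurable_fun.
have iG : (leb1 R).-integrable setT (EFin \o (fun t => C * expR (- t ^+ 2))).
  by apply: integrableZlr => //; exact: integrableT_gauss.
pose I (n : nat) : set T := `[- n%:R, n%:R]%classic.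
have mI n : measurable (I n) by exact: measurable_itv.
have [] := @dominated_convergence _ T R (leb1 R) setT measurableT
  (fun n => EFin \o (f \_ (I n))) (EFin \o f) (EFin \o (fun t => C * expR (- t ^+ 2))).
- move=> n; apply/measurable_EFinP/(measurable_restrict _ (mI n) measurableT).
  by apply: measurable_funS mf.
- exact/measurable_EFinP.
- apply: aeW => t _; apply: cvg_near_cst; near=> n.
  rewrite /= patchE mem_set// /I/= in_itv/= -ler_norml.
  rewrite (le_trans (ltW (truncnS_gt _)))// ler_nat.
  by near: n; exact: nbhs_infty_ge.
- exact: iG.
- apply: aeW => t n _; rewrite /= lee_fin patchE; case: ifPn => _; first exact: fC.
  by rewrite normr0 (le_trans _ (fC t)).
move=> _ _ lim1.
have lim2 : (\int[leb1 R]_t (EFin \o (f \_ (I n))) t)%E @[n --> \oo] --> (0%:E : \bar R).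
  rewrite (_ : (fun n => _) = (fun n : nat => (F n%:R - F (- n%:R))%:E)).
    apply: cvg_EFin; first exact: nearW.
    rewrite -(subr0 (0 : R)); apply: cvgB.
      by apply: cvg_gauss_bound FC _ => n; rewrite normr_nat.
    by apply: (@cvg_gauss_bound _ _ (fun n => - n%:R) FC) => n; rewrite normrN normr_nat.
  apply/funext => n.
  transitivity (\int[leb1 R]_(t in I n) (f t)%:E)%E.
    by rewrite [RHS]integral_mkcond/= restrict_EFin.
  have [->|n0] := eqVneq n 0%N.
    by rewrite /I oppr0 set_itv1 integral_set1 subrr.
  have ltn : - n%:R < n%:R :> R by rewrite gtrN// ltr0n lt0n.
  rewrite /I (@continuous_FTC2 _ f F)//.
  - exact: continuous_subspaceT.
  - split=> [x _||].
    + exact: (@ex_derive _ _ _ _ _ _ _ (dF x)).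
    + by apply: cvg_at_right_filter; exact: (derivable1_continuous (dF _)).
    + by apply: cvg_at_left_filter; exact: (derivable1_continuous (dF _)).
  - by move=> x _; rewrite derive1E (@derive_val _ _ _ _ _ _ _ (dF x)).
have := cvg_unique _ lim1 lim2; rewrite /Rintegral => -> //.
Unshelve. all: by end_near. Qed.

(** [expR (- x)] times [x ^+ n / n!] is a Poisson probability, hence at most 1. *)
Lemma expn_le_expR (x : R) n : 0 <= x -> x ^+ n <= n`!%:R * expR x.
Proof.
move=> x0; have f0 : 0 < n`!%:R :> R by rewrite ltr0n fact_gt0.
have : pois x n <= 1.
  rewrite (le_trans _ (pois_sum_le1 n.+1 x0))// big_ord_recr/= lerDr.
  by apply: sumr_ge0 => i _; exact: pois_ge0.
rewrite /pois expRN ler_pdivrMl ?expR_gt0// mulr1 ler_pdivrMr//.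
by rewrite mulrC.
Qed.

Lemma poly_expR_bound p : exists2 C : R, 0 <= C & forall t, `|p.[t]| <= C * expR (t ^+ 2).
Proof.
suff [n [C C0 h]] : exists n, exists2 C : R, 0 <= C &
    forall t, `|p.[t]| <= C * (1 + t ^+ 2) ^+ n.
  exists (C * (n`!%:R * expR 1)); first by rewrite !mulr_ge0 ?expR_ge0.
  move=> t; rewrite (le_trans (h t))// -2!mulrA -expRD ler_wpM2l//.
  by apply: expn_le_expR; rewrite addr_ge0 ?sqr_ge0.
elim/poly_ind: p => [|p c [n [C C0 h]]].
  by exists 0%N, 0 => // t; rewrite horner0 normr0 mul0r.
exists n.+1, (C + `|c|); first by rewrite addr_ge0.
move=> t; rewrite hornerMXaddC (le_trans (ler_normD _ _))// mulrDl.
have t1 : `|t| <= 1 + t ^+ 2.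
  rewrite ler_norml; apply/andP; split; nra.
apply: lerD.
  by rewrite normrM exprSr mulrA ler_pM.
by rewrite ler_peMr// exprn_ege1// lerDl sqr_ge0.
Qed.

(** The unnormalised product of the Gaussian window and its translate by [x]. *)
Definition gg (x t : R) : R := expR (- (pi * t ^+ 2) - pi * (t - x) ^+ 2).

Lemma continuous_gg x : continuous (gg x).
Proof.
move=> t.
have d1 := is_derive1Zl pi (is_derive1X 2 (is_derive_id t 1)).
have d2 := is_derive1Zl pi (is_derive1X 2 (is_derive1B (is_derive_id t 1) (is_derive_cst x t 1))).
exact: (derivable1_continuous (is_derive1_expR_comp (is_derive1B (is_derive1N d1) d2))).
Qed.

Lemma is_derive_gg (x t : R) : is_derive t 1 (gg x) ((- (4 * pi * t) + 2 * pi * x) * gg x t).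
Proof.
have d1 := is_derive1Zl pi (is_derive1X 2 (is_derive_id t 1)).
have d2 := is_derive1Zl pi (is_derive1X 2 (is_derive1B (is_derive_id t 1) (is_derive_cst x t 1))).
apply: (is_derive_eq (is_derive1_expR_comp (is_derive1B (is_derive1N d1) d2))).
by congr (_ * _); rewrite /=; ring.
Qed.

Lemma gg_bound p : exists2 C : R, 0 <= C &
  forall x t y, `|y| <= 1 -> `|p.[t] * gg x t * y| <= C * expR (- t ^+ 2).
Proof.
have [C C0 h] := poly_expR_bound p; exists C => // x t y y1.
rewrite !normrM (ger0_norm (expR_ge0 _)).
(* Since [pi >= 2], the factor [gg x t] is at most [expR (- (2 * t ^+ 2))] for every [x]; half of
   this decay absorbs the polynomial. *)
apply: (@le_trans _ _ (C * expR (t ^+ 2) * expR (- (2 * t ^+ 2)) * 1)); last first.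
  by rewrite mulr1 -mulrA -expRD (_ : _ + _ = - t ^+ 2)//; ring.
apply: ler_pM => //; apply: ler_pM => //.
rewrite ler_expR; have p2 := @pi_ge2 R.
have tx := sqr_ge0 (t - x); have t2 := sqr_ge0 t; nra.
Qed.

Lemma continuous_pgg p x q : continuous q -> continuous (fun t => p.[t] * gg x t * q t).
Proof.
move=> cq t; apply: cvgM; last exact: cq.
by apply: cvgM; [exact: continuous_horner|exact: continuous_gg].
Qed.

Lemma integrable_pgg p x q : continuous q -> (forall t, `|q t| <= 1) ->
  (leb1 R).-integrable setT (EFin \o (fun t => p.[t] * gg x t * q t)).
Proof.
move=> cq q1; have [C C0 h] := gg_bound p.
apply: (@integrable_gauss_bound _ C); last by move=> t; exact: h.
by apply: continuous_measurable_fun; exact: continuous_pgg.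
Qed.

Definition cw (w t : R) : R := cos (2 * pi * w * t).
Definition sw (w t : R) : R := sin (2 * pi * w * t).

Lemma cw_le1 w t : `|cw w t| <= 1. Proof. by rewrite ler_norml cos_geN1 cos_le1. Qed.
Lemma sw_le1 w t : `|sw w t| <= 1. Proof. by rewrite ler_norml sin_geN1 sin_le1. Qed.

Lemma is_derive_cw (w t : R) : is_derive t 1 (cw w) (- (2 * pi * w) * sw w t).
Proof.
apply: (is_derive_eq (is_derive1_cos_comp (is_derive1Zl (2 * pi * w) (is_derive_id t 1)))).
by rewrite mulr1 mulNr.
Qed.

Lemma is_derive_sw (w t : R) : is_derive t 1 (sw w) ((2 * pi * w) * cw w t).
Proof.
apply: (is_derive_eq (is_derive1_sin_comp (is_derive1Zl (2 * pi * w) (is_derive_id t 1)))).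
by rewrite mulr1.
Qed.

Lemma continuous_cw w : continuous (cw w).
Proof. by move=> t; exact: derivable1_continuous (is_derive_cw w t). Qed.

Lemma continuous_sw w : continuous (sw w).
Proof. by move=> t; exact: derivable1_continuous (is_derive_sw w t). Qed.

(** Together with [sint], the real part and minus the imaginary part of the integral of
    [p(t) gg x t exp(-2 pi i w t)] over [t]. *)
Definition cint p x w : R := Rintegral (leb1 R) setT (fun t => p.[t] * gg x t * cw w t).
Definition sint p x w : R := Rintegral (leb1 R) setT (fun t => p.[t] * gg x t * sw w t).

Lemma cint_integrable p x w :
  (leb1 R).-integrable setT (EFin \o (fun t => p.[t] * gg x t * cw w t)).
Proof. by apply: integrable_pgg; [exact: continuous_cw|exact: cw_le1]. Qed.

Lemma sint_integrable p x w :
  (leb1 R).-integrable setT (EFin \o (fun t => p.[t] * gg x t * sw w t)).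
Proof. by apply: integrable_pgg; [exact: continuous_sw|exact: sw_le1]. Qed.

Lemma cintD p p' x w : cint (p + p') x w = cint p x w + cint p' x w.
Proof.
rewrite /cint -RintegralD//; try exact: cint_integrable.
by apply: eq_Rintegral => t _; rewrite hornerD !mulrDl.
Qed.

Lemma cintZ c p x w : cint (c *: p) x w = c * cint p x w.
Proof.
rewrite /cint -RintegralZl//; try exact: cint_integrable.
by apply: eq_Rintegral => t _; rewrite hornerZ !mulrA.
Qed.

Lemma sintZ c p x w : sint (c *: p) x w = c * sint p x w.
Proof.
rewrite /sint -RintegralZl//; try exact: sint_integrable.
by apply: eq_Rintegral => t _; rewrite hornerZ !mulrA.
Qed.

(* [raise p * gg x] integrates by parts to [2 pi (x - i w)] times the overlap of [p]. *)
Let raise p : {poly R} := (4 * pi) *: ('X * p) - p^`().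

(** The function [f] in the proof, whose integral is 0, is the derivative of [p gg u]. Taking
    [(u, v)] as cosine and sine or the reverse, with [k = - 2 pi w] or [2 pi w], yields both parts
    of the overlap. *)
Let ibp p x (u v : R -> R) (k : R) :
  (forall t : R, is_derive t 1 u (k * v t)) -> (forall t, `|u t| <= 1) ->
  (forall t, `|v t| <= 1) -> continuous u -> continuous v ->
  Rintegral (leb1 R) setT (fun t => (raise p).[t] * gg x t * u t) =
  2 * pi * x * Rintegral (leb1 R) setT (fun t => p.[t] * gg x t * u t) +
  k * Rintegral (leb1 R) setT (fun t => p.[t] * gg x t * v t).
Proof.
move=> du u1 v1 cu cv.
pose f t := ((- raise p).[t] * gg x t * u t + 2 * pi * x * (p.[t] * gg x t * u t))
  + k * (p.[t] * gg x t * v t).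
have i1 := integrable_pgg (- raise p) x cu u1.
have i2 := integrable_pgg (raise p) x cu u1.
have i3 := integrable_pgg p x cu u1.
have i4 := integrable_pgg p x cv v1.
have i3' := integrableZlr measurableT (2 * pi * x) i3.
have i4' := integrableZlr measurableT k i4.
have : Rintegral (leb1 R) setT f = 0.
  have [C1 C10 h1] := gg_bound (- raise p); have [C2 C20 h2] := gg_bound p.
  set C := C1 + `|2 * pi * x| * C2 + `|k| * C2 + C2.
  apply: (@integral_derivative_eq0 (fun t => p.[t] * gg x t * u t) f C).
  - move=> t; have d := is_derive1M (is_derive1M (is_derive_poly p t) (is_derive_gg x t)) (du t).
    apply: (is_derive_eq d); rewrite /f /raise hornerN hornerD hornerN hornerZ hornerM hornerX.
    by ring.
  - move=> t; apply: cvgD; first apply: cvgD.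
    + exact: continuous_pgg.
    + by apply: cvgMl_tmp; exact: continuous_pgg.
    + by apply: cvgMl_tmp; exact: continuous_pgg.
  - move=> t; rewrite /f [leRHS](_ : _ = C1 * expR (- t ^+ 2) +
      `|2 * pi * x| * (C2 * expR (- t ^+ 2)) + `|k| * (C2 * expR (- t ^+ 2)) +
      C2 * expR (- t ^+ 2)); last by rewrite /C; ring.
    rewrite (le_trans (ler_normD _ _))// -[leLHS]addr0.
    apply: lerD; last by rewrite mulr_ge0 ?expR_ge0.
    apply: lerD; last by rewrite normrM ler_wpM2l// h2.
    rewrite (le_trans (ler_normD _ _))//; apply: lerD; first by rewrite h1.
    by rewrite normrM ler_wpM2l// h2.
  - move=> t; rewrite (le_trans (h2 x t (u t) (u1 t)))// ler_wpM2r ?expR_ge0//.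
    by rewrite lerDr !addr_ge0// mulr_ge0.
rewrite /f RintegralD//; last by apply: integrableDr.
rewrite RintegralD// !RintegralZl//.
have -> : Rintegral (leb1 R) setT (fun t => (- raise p).[t] * gg x t * u t) =
    - Rintegral (leb1 R) setT (fun t => (raise p).[t] * gg x t * u t).
  transitivity (Rintegral (leb1 R) setT (fun t => -1 * ((raise p).[t] * gg x t * u t))).
    by apply: eq_Rintegral => t _; rewrite hornerN; ring.
  by rewrite RintegralZl// mulN1r.
by move=> h; lra.
Qed.

Lemma cint_raise p x w : cint ((4 * pi) *: ('X * p) - p^`()) x w =
  2 * pi * (x * cint p x w - w * sint p x w).
Proof.
rewrite /cint (ibp p x (is_derive_cw w) (cw_le1 w) (sw_le1 w) (@continuous_cw w) (@continuous_sw w)).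
by rewrite /sint; ring.
Qed.

Lemma sint_raise p x w : sint ((4 * pi) *: ('X * p) - p^`()) x w =
  2 * pi * (x * sint p x w + w * cint p x w).
Proof.
rewrite /sint (ibp p x (is_derive_sw w) (sw_le1 w) (cw_le1 w) (@continuous_sw w) (@continuous_cw w)).
by rewrite /cint; ring.
Qed.

End gaussian_bounds.

(** * The overlap of two Gaussians *)

Section gaussian_overlap.
Context {R : realType}.
Implicit Types (x w : R) (p : {poly R}).

Lemma is_derive_cint p x w :
  is_derive w 1 (cint p x) (- (2 * pi) * sint ('X * p) x w).
Proof.
pose f (w t : R) := p.[t] * gg x t * cw w t.
have df (w' t : R) : is_derive w' 1 (f ^~ t) (- (2 * pi) * (('X * p).[t] * gg x t * sw w' t)).
  have dl := is_derive1M (is_derive1Zl (2 * pi) (is_derive_id w' 1)) (is_derive_cst t w' 1).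
  apply: (is_derive_eq (is_derive1Zl (p.[t] * gg x t) (is_derive1_cos_comp dl))).
  by rewrite hornerM hornerX /sw /=; ring.
have Iw : `]w - 1, w + 1[%classic w by rewrite /= in_itv/=; apply/andP; split; lra.
have [C C0 hC] := gg_bound ('X * p).
pose G t : R := `|2 * pi| * (C * expR (- t ^+ 2)).
have G0 t : 0 <= G t by rewrite !mulr_ge0 ?expR_ge0.
have iG : (leb1 R).-integrable setT (EFin \o G).
  by apply: integrableZlr => //; apply: integrableZlr => //; exact: integrableT_gauss.
have int_f (w' : R) : `]w - 1, w + 1[%classic w' ->
    (leb1 R).-integrable setT (EFin \o f w').
  by move=> _; exact: cint_integrable.
have der_f (w' t : R) : `]w - 1, w + 1[%classic w' -> setT t -> derivable (f ^~ t) w' 1.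
  by move=> _ _; exact: (@ex_derive _ _ _ _ _ _ _ (df w' t)).
have G_ub (w' t : R) : `]w - 1, w + 1[%classic w' -> setT t -> `|partial1of2 f w' t| <= G t.
  move=> _ _; rewrite partial1of2E (@derive_val _ _ _ _ _ _ _ (df w' t)) mulNr normrN normrM.
  by rewrite ler_wpM2l// hC// sw_le1.
have D1 := @derivable_under_integral R _ _ (leb1 R) f setT measurableT w (w - 1) (w + 1)
  Iw int_f der_f G G0 iG G_ub.
have D2 := @differentiation_under_integral R _ _ (leb1 R) f setT measurableT w (w - 1) (w + 1)
  Iw int_f der_f G G0 iG G_ub.
apply: DeriveDef; first exact: D1.
rewrite -derive1E D2.
transitivity (Rintegral (leb1 R) setT (fun t => - (2 * pi) * (('X * p).[t] * gg x t * sw w t))).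
  by apply: eq_Rintegral => t _; rewrite partial1of2E (@derive_val _ _ _ _ _ _ _ (df w t)).
by rewrite RintegralZl//; exact: sint_integrable.
Qed.

Lemma is_derive_sint p x w :
  is_derive w 1 (sint p x) ((2 * pi) * cint ('X * p) x w).
Proof.
pose f (w t : R) := p.[t] * gg x t * sw w t.
have df (w' t : R) : is_derive w' 1 (f ^~ t) ((2 * pi) * (('X * p).[t] * gg x t * cw w' t)).
  have dl := is_derive1M (is_derive1Zl (2 * pi) (is_derive_id w' 1)) (is_derive_cst t w' 1).
  apply: (is_derive_eq (is_derive1Zl (p.[t] * gg x t) (is_derive1_sin_comp dl))).
  by rewrite hornerM hornerX /cw /=; ring.
have Iw : `]w - 1, w + 1[%classic w by rewrite /= in_itv/=; apply/andP; split; lra.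
have [C C0 hC] := gg_bound ('X * p).
pose G t : R := `|2 * pi| * (C * expR (- t ^+ 2)).
have G0 t : 0 <= G t by rewrite !mulr_ge0 ?expR_ge0.
have iG : (leb1 R).-integrable setT (EFin \o G).
  by apply: integrableZlr => //; apply: integrableZlr => //; exact: integrableT_gauss.
have int_f (w' : R) : `]w - 1, w + 1[%classic w' ->
    (leb1 R).-integrable setT (EFin \o f w').
  by move=> _; exact: sint_integrable.
have der_f (w' t : R) : `]w - 1, w + 1[%classic w' -> setT t -> derivable (f ^~ t) w' 1.
  by move=> _ _; exact: (@ex_derive _ _ _ _ _ _ _ (df w' t)).
have G_ub (w' t : R) : `]w - 1, w + 1[%classic w' -> setT t -> `|partial1of2 f w' t| <= G t.
  move=> _ _; rewrite partial1of2E (@derive_val _ _ _ _ _ _ _ (df w' t)) normrM.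
  by rewrite ler_wpM2l// hC// cw_le1.
have D1 := @derivable_under_integral R _ _ (leb1 R) f setT measurableT w (w - 1) (w + 1)
  Iw int_f der_f G G0 iG G_ub.
have D2 := @differentiation_under_integral R _ _ (leb1 R) f setT measurableT w (w - 1) (w + 1)
  Iw int_f der_f G G0 iG G_ub.
apply: DeriveDef; first exact: D1.
rewrite -derive1E D2.
transitivity (Rintegral (leb1 R) setT (fun t => (2 * pi) * (('X * p).[t] * gg x t * cw w t))).
  by apply: eq_Rintegral => t _; rewrite partial1of2E (@derive_val _ _ _ _ _ _ _ (df w t)).
by rewrite RintegralZl//; exact: cint_integrable.
Qed.

Lemma gaussian_integral (m : R) :
  (leb1 R).-integrable setT (EFin \o (fun t => expR (- (2 * pi * (t - m) ^+ 2)))) /\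
  Rintegral (leb1 R) setT (fun t => expR (- (2 * pi * (t - m) ^+ 2))) = (Num.sqrt 2)^-1.
Proof.
have p0 : 0 < (pi : R) := pi_gt0 R.
(* The normal density of variance [1 / (4 pi)] is [sqrt 2] times the integrand. *)
pose s : R := Num.sqrt (4 * pi)^-1.
have s2 : s ^+ 2 = (4 * pi)^-1 by rewrite sqr_sqrtr// invr_ge0 mulr_ge0// ltW.
have s0 : s != 0 by rewrite gt_eqF// sqrtr_gt0 invr_gt0 mulr_gt0.
have r2 : 0 < Num.sqrt (2 : R) by rewrite sqrtr_gt0.
have pdfE : normal_pdf m s = fun t => Num.sqrt 2 * expR (- (2 * pi * (t - m) ^+ 2)).
  rewrite normal_pdfE//; apply/funext => t; rewrite /normal_peak /normal_fun s2.
  have pn : (pi : R) != 0 by exact: lt0r_neq0.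
  have e1 (P : R) : P != 0 -> (4 * P)^-1 *+ 2 = (2 * P)^-1.
    by move=> P0; rewrite mulr2n; field.
  rewrite e1// invrK; congr (_ * expR _); last by ring.
  have e2 (P : R) : P != 0 -> (4 * P)^-1 * P *+ 2 = 2^-1.
    by move=> P0; rewrite mulr2n; field.
  by rewrite e2// sqrtrV ?invrK.
have E t : expR (- (2 * pi * (t - m) ^+ 2)) = (Num.sqrt 2)^-1 * normal_pdf m s t.
  by rewrite pdfE mulKf// lt0r_neq0.
have iN := @integrable_normal_pdf R m s.
have -> : (fun t : R => expR (- (2 * pi * (t - m) ^+ 2))) =
    (fun t => (Num.sqrt 2)^-1 * normal_pdf m s t) by apply/funext => t; exact: E.
split; first exact: integrableZlr.
by rewrite RintegralZl// [X in _ * X]/Rintegral integral_normal_pdf// mulr1.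
Qed.

Lemma cint1_0 x : cint 1 x 0 = expR (- (pi * x ^+ 2 / 2)) / Num.sqrt 2.
Proof.
have [i e] := gaussian_integral (x / 2).
rewrite -e -RintegralZl//; apply: eq_Rintegral => t _.
by rewrite hornerC mul1r /gg /cw mulr0 mul0r cos0 mulr1 -expRD; congr expR; field.
Qed.

Lemma sint_0 p x : sint p x 0 = 0.
Proof.
transitivity (Rintegral (leb1 R) setT (fun=> (0 : R))); last by rewrite Rintegral_cst// mul0r.
by apply: eq_Rintegral => t _; rewrite /sw mulr0 mul0r sin0 mulr0.
Qed.

(* The squared overlap of two Gaussians satisfies [N' = - 2 pi w N] in the frequency [w]. *)
Lemma overlap_sq x w : cint 1 x w ^+ 2 + sint 1 x w ^+ 2 =
  2^-1 * expR (- (pi * (x ^+ 2 + w ^+ 2))).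
Proof.
(* The derivative of 1 vanishes, so raising 1 is multiplication by [4 pi X]: the first moments
   produced by differentiating in [w] are again overlaps of 1, which closes the differential
   equation. *)
have X1 : (4 * pi) *: ('X * 1) - 1^`() = (4 * pi) *: ('X * 1) :> {poly R}.
  by rewrite derivC subr0.
have cX u : 2 * cint ('X * 1) x u = x * cint 1 x u - u * sint 1 x u.
  have := cint_raise 1 x u; rewrite X1 cintZ => h.
  apply: (mulfI (_ : 2 * pi != 0)); first by rewrite mulf_neq0// gt_eqF// pi_gt0.
  by rewrite -h; ring.
have sX u : 2 * sint ('X * 1) x u = x * sint 1 x u + u * cint 1 x u.
  have := sint_raise 1 x u; rewrite X1 sintZ => h.
  apply: (mulfI (_ : 2 * pi != 0)); first by rewrite mulf_neq0// gt_eqF// pi_gt0.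
  by rewrite -h; ring.
have D (u : R) : is_derive u 1
    (fun w => (cint 1 x w ^+ 2 + sint 1 x w ^+ 2) * expR (pi * w ^+ 2)) 0.
  have d1 := is_derive1D (is_derive1X 2 (is_derive_cint 1 x u)) (is_derive1X 2 (is_derive_sint 1 x u)).
  have d2 := is_derive1_expR_comp (is_derive1Zl pi (is_derive1X 2 (is_derive_id u 1))).
  apply: (is_derive_eq (is_derive1M d1 d2)).
  rewrite [LHS](_ : _ = 2 * pi * expR (pi * u ^+ 2) *
    (sint 1 x u * (2 * cint ('X * 1) x u) - cint 1 x u * (2 * sint ('X * 1) x u)
     + u * (cint 1 x u ^+ 2 + sint 1 x u ^+ 2))); last by ring.
  by rewrite cX sX; ring.
have h : (cint 1 x w ^+ 2 + sint 1 x w ^+ 2) * expR (pi * w ^+ 2) =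
    2^-1 * expR (- (pi * x ^+ 2)).
  rewrite (is_derive_0_is_cst w 0 D) sint_0 cint1_0.
  rewrite !expr0n/= mulr0 expR0 mulr1 addr0 exprMn exprVn sqr_sqrtr// mulrC.
  by rewrite expr2 -expRD; congr (_ * expR _); field.
apply: (mulIf (_ : expR (pi * w ^+ 2) != 0)); first by rewrite gt_eqF// expR_gt0.
by rewrite h -mulrA -expRD; congr (_ * expR _); ring.
Qed.

End gaussian_overlap.

Lemma cRM (R : realType) (x y : R) : (x * y)%:C = x%:C * y%:C.
Proof. by apply: complexP => /=; ring. Qed.

Lemma complex_power_mulJ (R : realType) (a b c : R) (s w : R[i]) n m :
  a%:C * ((c%:C * s) ^+ n * w) * (b%:C * ((c%:C * s) ^+ m * w))^* =
  (a * b * c ^+ (n + m))%:C * (s ^+ n * (s^*) ^+ m) * (w * w^*).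
Proof.
have cM (x y : R[i]) : (x * y)^* = x^* * y^*.
  by apply: complexP; rewrite !(cReM, cImM, cReJ, cImJ); ring.
have cX (x : R[i]) k : (x ^+ k)^* = x^* ^+ k.
  elim: k => [|k IH]; first by rewrite !expr0; apply: complexP; rewrite /= ?oppr0.
  by rewrite exprS cM [RHS]exprS; congr (_ * _); exact: IH.
have rX (x : R) k : (x ^+ k)%:C = x%:C ^+ k.
  by elim: k => [|k IH]; rewrite ?expr0// !exprS cRM IH.
rewrite !cM !cX !cM !conj_real !cRM rX !exprMn exprD.
move: (s^*) (w^*) => s' w'; move: (a%:C) (b%:C) (c%:C) => a' b' c'.
by ring.
Qed.

(** * Hermite functions, coherent states and their overlaps *)

Section hermite.
Context {R : realType}.
Implicit Types (n m : nat) (z : R * R).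

(** The recursion produces [(2 pi)^(n/2) H_n(sqrt(2 pi) t)] with [H_n] the physicists' Hermite
    polynomials, orthogonal for the weight [exp(-2 pi t^2)]. *)
Fixpoint herm n : {poly R} :=
  if n is m.+1 then (4 * pi) *: ('X * herm m) - (herm m)^`() else 1.

Lemma deriv_herm n : (herm n)^`() = (4 * pi * n%:R) *: herm n.-1.
Proof.
elim: n => [|n IH]; first by rewrite derivC mulr0 scale0r.
rewrite [LHS]/= derivB derivZ derivM derivX mul1r IH derivZ.
case: n IH => [|n] IH; first by rewrite !(mulr0, scale0r) subr0 addr0 mulr1.
rewrite -[n.+1.-1]/n -[n.+2.-1]/n.+1.
have -> : ('X * ((4 * pi * n.+1%:R) *: herm n)) =
   (4 * pi * n.+1%:R) *: ('X * herm n) by rewrite scalerAr.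
rewrite scalerDr scalerA (mulrC (4 * pi) (_ * n.+1%:R)).
rewrite -(scalerA (4 * pi * n.+1%:R) (4 * pi)) -addrA -scalerBr.
rewrite -[_ - _]/(herm n.+1) -scalerDl -(natr1 n.+1).
by congr (_ *: _); ring.
Qed.

Let I (p : {poly R}) := cint p 0 0.

Let I_raise (p q : {poly R}) :
  I (((4 * pi) *: ('X * p) - p^`()) * q) = I (p * q^`()).
Proof.
have -> : ((4 * pi) *: ('X * p) - p^`()) * q =
   ((4 * pi) *: ('X * (p * q)) - (p * q)^`()) + p * q^`().
  by rewrite derivM mulrBl -scalerAl mulrA opprD addrA subrK.
by rewrite /I cintD cint_raise !mul0r subrr mulr0 add0r.
Qed.

Let I0 : I 0 = 0.
Proof. by rewrite /I -(scale0r (0 : {poly R})) cintZ mul0r. Qed.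

(** For the weight [gg 0] raising is adjoint to differentiation ([I_raise]), and differentiation
    lowers the index with a factor [4 pi n] ([deriv_herm]); the induction lowers both indices
    together. *)
Lemma herm_orthogonal n m :
  cint (herm n * herm m) 0 0 = (n == m)%:R * ((4 * pi) ^+ n * n`!%:R / Num.sqrt 2).
Proof.
rewrite -/(I _); elim: n m => [|n IH] [|m].
- by rewrite /= mul1r /I cint1_0 expr0n/= mulr0 mul0r oppr0 expR0 expr0 !mul1r.
- by rewrite mulrC [herm m.+1]/= I_raise derivC mulr0 I0 mul0r.
- by rewrite [herm n.+1]/= I_raise derivC mulr0 I0 mul0r.
rewrite [herm n.+1]/= I_raise deriv_herm -scalerAr /I cintZ -/(I _) IH eqSS.
have [->|_] := eqVneq n m; last by rewrite !mul0r mulr0.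
by rewrite exprS factS natrM; ring.
Qed.

Let g4 : R := 2 `^ 4^-1.

Let g4_sq : g4 ^+ 2 = Num.sqrt 2.
Proof.
rewrite -powR_mulrn ?powR_ge0// -powRrM -powR12_sqrt//; congr (_ `^ _).
by field.
Qed.

Definition hnorm n : R := Num.sqrt (Num.sqrt 2 / ((4 * pi) ^+ n * n`!%:R)).

Lemma hnorm_sq n : hnorm n ^+ 2 = Num.sqrt 2 / ((4 * pi) ^+ n * n`!%:R).
Proof.
rewrite sqr_sqrtr// divr_ge0 ?sqrtr_ge0// mulr_ge0//.
by rewrite exprn_ge0// mulr_ge0// pi_ge0.
Qed.

Definition hfun n (t : R) : R[i] := (hnorm n * (herm n).[t] * expR (- (pi * t ^+ 2)))%:C.

Let hfun_sq n t : sqc (hfun n t) = hnorm n ^+ 2 * ((herm n * herm n).[t] * gg 0 t * cw 0 t).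
Proof.
rewrite /sqc /hfun/= expr0n addr0 /gg /cw mulr0 mul0r cos0 subr0 hornerM.
by rewrite expRD; ring.
Qed.

Lemma hfun_L2 n : L2 (hfun n).
Proof.
apply: (L2_of_bound _ (integrableZlr measurableT (hnorm n ^+ 2) (cint_integrable (herm n * herm n) 0 0))).
  split; last exact: measurable_cst.
  apply: continuous_measurable_fun => t; apply: cvgM.
    by apply: cvgMl_tmp; exact: continuous_horner.
  have d := is_derive1N (is_derive1Zl pi (is_derive1X 2 (is_derive_id t 1))).
  exact: (derivable1_continuous (is_derive1_expR_comp d)).
by move=> t; rewrite hfun_sq.
Qed.

Lemma hfun_orthonormal n m : inner (hfun n) (hfun m) = (n == m)%:R.
Proof.
have -> : inner (hfun n) (hfun m) = (hnorm n * hnorm m * cint (herm n * herm m) 0 0)%:C.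
  apply: complexP => /=.
    rewrite -RintegralZl//; last exact: cint_integrable.
    apply: eq_Rintegral => t _.
    by rewrite /gg /cw mulr0 mul0r cos0 subr0 hornerM expRD; ring.
  rewrite (_ : (fun t => _) = fun=> 0); first by rewrite Rintegral_cst// mul0r.
  by apply/funext => t; ring.
rewrite herm_orthogonal; have [->|_] := eqVneq n m; last by rewrite mul0r mulr0.
rewrite mul1r -expr2 hnorm_sq (_ : _ * _ = 1)//.
have f0 : m`!%:R != 0 :> R by rewrite pnatr_eq0 -lt0n fact_gt0.
have p0 : (pi : R) != 0 by rewrite gt_eqF// pi_gt0.
have q0 : (4 * pi : R) ^+ m != 0 by rewrite expf_neq0// mulf_neq0.
have r0 : Num.sqrt (2 : R) != 0 by rewrite gt_eqF// sqrtr_gt0.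
by field; rewrite f0 q0 r0.
Qed.

Definition coherent z : R -> R[i] := tfshift z (@gaussian R).

Let coherent_sq z t : sqc (coherent z t) = Num.sqrt 2 * expR (- (2 * pi * (t - z.1) ^+ 2)).
Proof.
rewrite /coherent /tfshift sqcM /sqc /cis /gaussian/= cos2Dsin2 mul1r expr0n addr0.
rewrite exprMn -/g4 g4_sq; congr (_ * _); rewrite expr2 -expRD; congr expR; ring.
Qed.

Lemma coherent_L2 z : L2 (coherent z).
Proof.
have [i _] := gaussian_integral z.1.
apply: (L2_of_bound _ (integrableZlr measurableT (Num.sqrt 2) i)); last first.
  by move=> t; rewrite -coherent_sq.
have cg : continuous (fun t : R => expR (- (pi * (t - z.1) ^+ 2))).
  move=> t; have d := is_derive1N (is_derive1Zl pi (is_derive1X 2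
    (is_derive1B (is_derive_id t 1) (is_derive_cst z.1 t 1)))).
  exact: (derivable1_continuous (is_derive1_expR_comp d)).
split.
  rewrite (_ : (fun t => _) = fun t => cw z.2 t * (g4 * expR (- (pi * (t - z.1) ^+ 2)))).
    apply: continuous_measurable_fun => t; apply: cvgM; first exact: continuous_cw.
    by apply: cvgMl_tmp; exact: cg.
  by apply/funext => t; rewrite cReM/= mulr0 subr0.
rewrite (_ : (fun t => _) = fun t => sw z.2 t * (g4 * expR (- (pi * (t - z.1) ^+ 2)))).
  apply: continuous_measurable_fun => t; apply: cvgM; first exact: continuous_sw.
  by apply: cvgMl_tmp; exact: cg.
by apply/funext => t; rewrite cImM/= mulr0 add0r.
Qed.

Lemma coherent_normsq z : normsq (coherent z) = 1.
Proof.
have [i e] := gaussian_integral z.1.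
transitivity (Rintegral (leb1 R) setT (fun t => Num.sqrt 2 * expR (- (2 * pi * (t - z.1) ^+ 2)))).
  by apply: eq_Rintegral => t _; rewrite coherent_sq.
by rewrite RintegralZl// e mulfV// gt_eqF// sqrtr_gt0.
Qed.

Let W n z : R[i] := cint (herm n) z.1 z.2 +i* (- sint (herm n) z.1 z.2).

Let WS n z : W n.+1 z = ((2 * pi)%:C * (z.1 +i* (- z.2))) * W n z.
Proof.
apply: complexP; rewrite [in LHS]/W /= ?cint_raise ?sint_raise; ring.
Qed.

(** Each raising multiplies the overlap by [2 pi (x - i w)]: up to the common factor [W 0], Hermite
    functions become monomials in the conjugate variable. *)
Let WE n z : W n z = ((2 * pi)%:C * (z.1 +i* (- z.2))) ^+ n * W 0 z.
Proof.
elim: n => [|n IH]; first by rewrite expr0 mul1r.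
by rewrite WS IH exprS mulrA.
Qed.

Let stft_hfunE n z : stft (@gaussian R) (hfun n) z = (hnorm n * g4)%:C * W n z.
Proof.
apply: complexP; rewrite ?cReM ?cImM /= mul0r ?subr0 ?addr0.
  rewrite -RintegralZl//; last exact: cint_integrable.
  apply: eq_Rintegral => t _; rewrite /hfun /tfshift /cis /gaussian -/g4.
  by rewrite /gg /cw expRD; ring.
rewrite mulrN -mulNr -RintegralZl//; last exact: sint_integrable.
apply: eq_Rintegral => t _; rewrite /hfun /tfshift /cis /gaussian -/g4.
by rewrite /gg /sw expRD; ring.
Qed.

(* The area of the disk through [z]. *)
Definition qz z : R := pi * (z.1 ^+ 2 + z.2 ^+ 2).

(** The Gaussian overlap [W 0] enters through its squared modulus, given by [overlap_sq]; all
    angular dependence sits in the two powers. *)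
Lemma stft_hfun_mulJ n m z :
  stft (@gaussian R) (hfun n) z * (stft (@gaussian R) (hfun m) z)^* =
  (hnorm n * hnorm m * Num.sqrt 2 * (2 * pi) ^+ (n + m) * 2^-1 * expR (- qz z))%:C *
    ((z.1 +i* (- z.2)) ^+ n * (z.1 +i* z.2) ^+ m).
Proof.
have W0 : W 0 z * (W 0 z)^* = (2^-1 * expR (- qz z))%:C.
  by rewrite mulcJ /sqc/= sqrrN overlap_sq.
rewrite (stft_hfunE n) (stft_hfunE m) (WE n) (WE m) complex_power_mulJ W0 -g4_sq.
rewrite (_ : (z.1 +i* (- z.2))^* = z.1 +i* z.2); last first.
  by apply: complexP; rewrite ?cReJ ?cImJ /= ?opprK.
by rewrite mulrAC -cRM; congr (_%:C * _); ring.
Qed.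

Lemma sqc_stft_hfun n z : sqc (stft (@gaussian R) (hfun n) z) = pois (qz z) n.
Proof.
have sR (x : R) : sqc (x%:C : R[i]) = x ^+ 2 by rewrite /sqc/= expr0n addr0.
rewrite stft_hfunE WE !sqcM sqcX sqcM !sR.
have -> : sqc (W 0 z) = 2^-1 * expR (- qz z) by rewrite /sqc/= sqrrN overlap_sq.
have -> : (2 * pi) ^+ 2 * sqc (z.1 +i* - z.2) = 4 * pi * qz z.
  by rewrite /sqc /qz /= sqrrN; ring.
rewrite [(hnorm n * g4) ^+ 2]exprMn hnorm_sq g4_sq [(4 * pi * _) ^+ n]exprMn /pois.
have f0 : n`!%:R != 0 :> R by rewrite pnatr_eq0 -lt0n fact_gt0.
have q0 : (4 * pi : R) ^+ n != 0 by rewrite expf_neq0// mulf_neq0// gt_eqF// pi_gt0.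
have r2 : Num.sqrt (2 : R) * Num.sqrt 2 = 2 by rewrite -expr2 sqr_sqrtr.
move: q0 f0; move: ((4 * pi) ^+ n) (n`!%:R) (qz z ^+ n) (expR _) => a b c e a0 b0.
transitivity ((Num.sqrt 2 * Num.sqrt 2) / 2 * (e * (c / b))).
  by field; rewrite b0 a0.
by rewrite r2 mulfV// mul1r.
Qed.

End hermite.

(** * Hermite expansion of coherent states *)

Section hermite_expansion.
Context {R : realType}.
Implicit Types (f : R -> R[i]) (z : R * R) (n m N : nat).

Local Notation V := (stft (@gaussian R)).

Lemma inner_coherent f z : inner f (coherent z) = V f z. Proof. by []. Qed.

(** The difference is the pairing of [f] with the part [u] of the coherent state orthogonal to the
    first [N] Hermite functions. By Pythagoras the squared norm of [u] is 1 minus their Poisson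
    weights, and Cauchy-Schwarz concludes. *)
Lemma stft_expansion f z N : L2 f ->
  sqc (V f z - \sum_(i < N) inner f (hfun i) * V (hfun i) z) <=
  normsq f * (1 - \sum_(i < N) pois (qz z) i).
Proof.
move=> f2; pose b (i : 'I_N) : R -> R[i] := hfun i.
pose a (i : 'I_N) := inner (coherent z) (hfun i).
have b2 i : L2 (b i) by exact: hfun_L2.
have c2 := coherent_L2 z.
have aJ i : (a i)^* = V (hfun i) z.
  by rewrite /a (innerC (hfun_L2 i) c2) inner_coherent conjCK.
have S2 : L2 (lincomb a b) by exact: L2_lincomb.
have nS2 : L2 (fun t => -1 * lincomb a b t) by exact: L2Z.
pose u t := coherent z t + -1 * lincomb a b t.
have u2 : L2 u by exact: L2D.
have N1 : (-1 : R[i])^* = -1 by rewrite rmorphN rmorph1.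
have Sb (j : 'I_N) : inner (lincomb a b) (b j) = a j.
  rewrite inner_lincombl// (bigD1 j)//= hfun_orthonormal eqxx mulr1 big1 ?addr0// => i ij.
  by rewrite hfun_orthonormal (negbTE (_ : (i != j :> nat))) ?mulr0.
have ub (j : 'I_N) : inner u (b j) = 0.
  by rewrite innerDl// innerZl// Sb mulN1r subrr.
have uS : inner u (lincomb a b) = 0.
  rewrite (innerC S2 u2) inner_lincombl// big1 ?rmorph0// => i _.
  by rewrite (innerC u2 (b2 i)) ub rmorph0 mulr0.
have Sc : inner (lincomb a b) (coherent z) = (\sum_(i < N) pois (qz z) i)%:C.
  rewrite inner_lincombl// (_ : (\sum_(i < N) _)%:C = \sum_(i < N) (pois (qz z) i)%:C).
    by apply: eq_bigr => i _; rewrite inner_coherent -aJ mulcJ -sqc_stft_hfun -aJ sqcJ.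
  exact: rmorph_sum.
have fS : inner f (lincomb a b) = \sum_(i < N) inner f (hfun i) * V (hfun i) z.
  rewrite (innerC S2 f2) inner_lincombl// rmorph_sum; apply: eq_bigr => i _.
  transitivity ((a i)^* * (inner (b i) f)^*); first exact: rmorphM.
  by rewrite aJ (innerC f2 (b2 i)) conjCK mulrC.
have nu : normsq u = 1 - \sum_(i < N) pois (qz z) i.
  have : inner u u = (1 - \sum_(i < N) pois (qz z) i)%:C.
    rewrite {2}/u innerDr// innerZr// uS mulr0 addr0 innerDl// innerZl// Sc.
    by rewrite inner_self coherent_normsq mulN1r -raddfB.
  by rewrite inner_self => /(congr1 (@complex.Re _)).
have fu : inner f u = V f z - \sum_(i < N) inner f (hfun i) * V (hfun i) z.
  by rewrite innerDr// innerZr// N1 mulN1r fS inner_coherent.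
by rewrite -fu -nu; exact: cauchy_schwarz.
Qed.

(** The Poisson weights sum to 1, so the bound of [stft_expansion] tends to 0. *)
Lemma stft_eq0 f z : L2 f -> (forall n, inner f (hfun n) = 0) -> V f z = 0.
Proof.
move=> f2 f0; apply: sqc0; apply/eqP; rewrite eq_le sqc_ge0 andbT.
have l : normsq f * (1 - \sum_(i < N) pois (qz z) i) @[N --> \oo] --> normsq f * (1 - 1).
  by apply: cvgMl_tmp; apply: cvgB; [exact: cvg_cst|exact: pois_sum_cvg].
rewrite subrr mulr0 in l; apply: (cvgr_to_ge l); apply: nearW => N.
rewrite (le_trans _ (stft_expansion z N f2))// big1 ?subr0// => i _.
by rewrite f0 mul0r.
Qed.

End hermite_expansion.

(** * Planar annuli *)

Section plane.
Context {R : realType}.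
Implicit Types (c s x y : R) (z : R * R).

Local Notation T := (measurableTypeR R).
Local Notation leb := (leb1 R).
Local Notation mu2 := (leb2 R).

Lemma lebesgue_translation c (A : set T) : measurable A ->
  leb ((fun x => x + c) @^-1` A) = leb A.
Proof.
have mt : measurable_fun [set: T] (fun x : T => x + c : T).
  by apply: measurable_funD => //; exact: measurable_cst.
pose pm : {measure set T -> \bar R} := measure_function_pushforward__canonical__measure_function_Measure leb mt.
move=> mA; have := @lebesgue_measure_unique R pm _ A mA; rewrite /= /pushforward => h.
symmetry; apply: h => X [[a b] _ <-].
have -> : (fun x => x + c) @^-1` `]a, b]%classic = `](a - c), (b - c)]%classic.
  by apply/seteqP; split=> x /=; rewrite !in_itv/= ltrBlDr lerBrDr.
rewrite !lebesgue_measure_itv/= !lte_fin ltrD2r; case: ifP => // _.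
by rewrite -!EFinB; congr (_%:E); ring.
Qed.

Definition measure_preserving (phi : R * R -> R * R) :=
  measurable_fun [set: T * T] (phi : T * T -> T * T) /\
  forall A : set (T * T), measurable A -> mu2 (phi @^-1` A) = mu2 A.

Lemma measure_preserving_comp phi psi :
  measure_preserving phi -> measure_preserving psi -> measure_preserving (phi \o psi).
Proof.
move=> [m1 p1] [m2 p2]; split; first exact: measurableT_comp.
move=> A mA; rewrite comp_preimage p2 ?p1//.
by rewrite -[X in measurable X]setTI; exact: m1.
Qed.

Lemma Rintegral_measure_preserving phi (D : set (T * T)) (f : T * T -> R) :
  measure_preserving phi -> measurable D -> measurable_fun setT f ->
  mu2.-integrable (phi @^-1` D) (EFin \o (f \o phi)) ->
  Rintegral mu2 (phi @^-1` D) (f \o phi) = Rintegral mu2 D f.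
Proof.
move=> [mphi pphi] mD mf if_.
pose pm : {measure set (T * T) -> \bar R} := measure_function_pushforward__canonical__measure_function_Measure mu2 mphi.
rewrite /Rintegral; congr fine.
have mEf : measurable_fun [set: T * T] (EFin \o f) by exact/measurable_EFinP.
rewrite -[LHS](integral_pushforward mphi mEf if_ mD).
by apply: eq_measure_integral => A mA _; exact: pphi.
Qed.

Let measurable_shear_y c : measurable_fun [set: T * T] (fun z : T * T => (z.1, z.2 + c * z.1) : T * T).
Proof.
apply: measurable_fun_pair => //; apply: measurable_funD => //.
by apply: measurable_funM => //; exact: measurable_cst.
Qed.

Let measurable_shear_x c : measurable_fun [set: T * T] (fun z : T * T => (z.1 + c * z.2, z.2) : T * T).
Proof.
apply: measurable_fun_pair => //; apply: measurable_funD => //.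
by apply: measurable_funM => //; exact: measurable_cst.
Qed.

(** On rectangles the shear translates each vertical section; agreement on rectangles determines the
    product measure. *)
Lemma shear_y_preserving c : measure_preserving (fun z => (z.1, z.2 + c * z.1)).
Proof.
split=> [|X mX]; first exact: measurable_shear_y.
pose pm : {measure set (T * T) -> \bar R} :=
  measure_function_pushforward__canonical__measure_function_Measure mu2 (measurable_shear_y c).
rewrite -[LHS]/(pm X); symmetry; apply: product_measure_unique => // A B mA mB.
rewrite /pm /= /pushforward -product_measure1E// /= /product_measure1.
apply: eq_integral => x _ /=.
rewrite !xsectionE; have [xA|xA] := pselect (A x); last first.
  by congr (lebesgue_measure _); apply/seteqP; split=> y /= -[].
transitivity (leb ((fun y => y + c * x) @^-1` B)).
  by congr (lebesgue_measure _); apply/seteqP; split=> y /=; [case|].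
rewrite lebesgue_translation//.
by congr (lebesgue_measure _); apply/seteqP; split=> y /=; [|case].
Qed.

(** The order of integration is exchanged first, so that horizontal sections can be translated. *)
Lemma shear_x_preserving c : measure_preserving (fun z => (z.1 + c * z.2, z.2)).
Proof.
split=> [|X mX]; first exact: measurable_shear_x.
have swap (Y : set (T * T)) : measurable Y ->
    mu2 Y = (lebesgue_measure \x^ lebesgue_measure)%E Y.
  by move=> mY; apply: product_measure_unique => // A B mA mB; exact: product_measure2E.
pose pm : {measure set (T * T) -> \bar R} :=
  measure_function_pushforward__canonical__measure_function_Measure mu2 (measurable_shear_x c).
rewrite -[LHS]/(pm X); symmetry; apply: product_measure_unique => // A B mA mB.
rewrite /pm /= /pushforward swap; last first.
  by rewrite -[X in measurable X]setTI; apply: measurable_shear_x => //; exact: measurableX.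
rewrite -product_measure2E// /= /product_measure2.
apply: eq_integral => y _ /=.
rewrite !ysectionE; have [yB|yB] := pselect (B y); last first.
  by congr (lebesgue_measure _); apply/seteqP; split=> x /= -[].
transitivity (leb ((fun x => x + c * y) @^-1` A)).
  by congr (lebesgue_measure _); apply/seteqP; split=> x /=; [case|].
rewrite lebesgue_translation//.
by congr (lebesgue_measure _); apply/seteqP; split=> x /=; [|case].
Qed.

Definition rotation c s z : R * R := (c * z.1 - s * z.2, s * z.1 + c * z.2).

(* A rotation is a product of three shears. *)
Lemma rotation_preserving c s : c ^+ 2 + s ^+ 2 = 1 -> s != 0 ->
  measure_preserving (rotation c s).
Proof.
(* For a rotation angle [theta] this is [- tan (theta / 2)]. *)
move=> cs s0; pose t := - ((1 - c) / s).
have := measure_preserving_comp (measure_preserving_comp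
  (shear_x_preserving t) (shear_y_preserving s)) (shear_x_preserving t).
have sE : s ^+ 2 = 1 - c ^+ 2 by rewrite -cs; ring.
set phi := (X in measure_preserving X -> _); have -> // : phi = rotation c s.
apply/funext => -[x y]; rewrite /phi /rotation /= /t.
have e : y + s * (x + - ((1 - c) / s) * y) = s * x + c * y by field.
rewrite e; congr pair.
rewrite (_ : c * x - s * y = c * x - (s ^+ 2) / s * y); last by field.
by rewrite sE; field.
Qed.

End plane.

(** * Areas of disks *)

Section disk_area.
Context {R : realType}.
Implicit Types (x y t rho : R) (z : R * R).

Local Notation T := (measurableTypeR R).
Local Notation mu2 := (leb2 R).

Lemma measurable_qz : measurable_fun [set: T * T] (@qz R).
Proof.
apply: measurable_funM; first exact: measurable_cst.
by apply: measurable_funD; apply: measurable_funX.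
Qed.

Lemma semicircle_integral rho : 0 < rho ->
  (\int[leb1 R]_x (2 * Num.sqrt (rho ^+ 2 - x ^+ 2))%:E = (pi * rho ^+ 2)%:E)%E.
Proof.
move=> rho0; pose G x : R := 2 * Num.sqrt (rho ^+ 2 - x ^+ 2).
pose F t : R := rho * sin t.
have dF t : is_derive t 1 F (rho * cos t).
  exact: (is_derive1Zl rho (is_derive_sin t)).
have F'E : F^`()%classic = fun t => rho * cos t.
  by apply/funext => t; rewrite derive1E (@derive_val _ _ _ _ _ _ _ (dF t)).
have cF' : continuous (fun t : R => rho * cos t).
  by move=> t; apply: cvgMl_tmp; exact: continuous_cos.
have cG : continuous G.
  move=> x; apply: cvgMl_tmp.
  apply: (@continuous_comp _ _ _ (fun x : R => rho ^+ 2 - x ^+ 2) Num.sqrt); last exact: sqrt_continuous.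
  by apply: (derivable1_continuous (is_derive1B (is_derive_cst (rho ^+ 2) x 1) (is_derive1X 2 (is_derive_id x 1)))).
have pi0 := pi_gt0 R.
pose a : R := - (pi / 2); pose b : R := pi / 2.
have ab : a < b by rewrite /a /b; lra.
have Fb : F b = rho by rewrite /F sin_pihalf mulr1.
have Fa : F a = - rho by rewrite /F sinN sin_pihalf mulrN1.
(* Outside [[- rho, rho]] the radicand is negative and [Num.sqrt] is 0, so the integral over the
   line reduces to this segment, parametrised by [rho * sin t]. *)
transitivity (\int[leb1 R]_(x in `[F a, F b]) (G x)%:E)%E.
  rewrite Fa Fb [RHS]integral_mkcond; apply: eq_integral => x _.
  rewrite patchE; case: ifPn => // /negP; rewrite inE /= in_itv/= -ler_norml => /negP.
  rewrite -ltNge => xr; rewrite /G ler0_sqrtr ?mulr0//.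
  by rewrite subr_le0 -(real_normK (num_real x)) lerXn2r ?nnegrE ?(ltW rho0)// ltW.
have sub := @integration_by_substitution_increasing R F G a b (ltW ab).
apply: etrans; first apply: sub.
- by move=> t u ti ui tu; rewrite /F ltr_pM2l// ltr_sin.
- by rewrite F'E => t _; exact: cF'.
- rewrite F'E; apply/cvg_ex; exists (rho * cos a).
  by apply: cvg_at_right_filter; exact: cF'.
- rewrite F'E; apply/cvg_ex; exists (rho * cos b).
  by apply: cvg_at_left_filter; exact: cF'.
- split=> [t _||].
  + exact: (@ex_derive _ _ _ _ _ _ _ (dF t)).
  + by apply: cvg_at_right_filter; exact: (derivable1_continuous (dF _)).
  + by apply: cvg_at_left_filter; exact: (derivable1_continuous (dF _)).
- exact: continuous_subspaceT.
transitivity (\int[leb1 R]_(t in `[a, b]) (2 * rho ^+ 2 * cos t ^+ 2)%:E)%E.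
  apply: eq_integral => t; rewrite inE/= in_itv/= => ti.
  rewrite fctE F'E /G /F /=; congr (_%:E).
  have -> : rho ^+ 2 - (rho * sin t) ^+ 2 = (rho * cos t) ^+ 2.
    by rewrite !exprMn cos2sin2; ring.
  rewrite sqrtr_sqr ger0_norm; first by ring.
  by rewrite mulr_ge0 ?cos_ge0_pihalf// ltW.
have dH t : is_derive t 1 (fun t => rho ^+ 2 * (t + sin t * cos t)) (2 * rho ^+ 2 * cos t ^+ 2).
  have d := is_derive1Zl (rho ^+ 2) (is_derive1D (is_derive_id t 1)
    (is_derive1M (is_derive_sin t) (is_derive_cos t))).
  apply: (is_derive_eq d).
  have := cos2Dsin2 t => e; rewrite [LHS](_ : _ = rho ^+ 2 * (1 + cos t ^+ 2 - sin t ^+ 2)); last by ring.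
  by rewrite -{1}e; ring.
rewrite (@continuous_FTC2 _ _ (fun t => rho ^+ 2 * (t + sin t * cos t))).
- by rewrite /a /b sinN cosN cos_pihalf -EFinB; congr (_%:E); field.
- exact: ab.
- apply: continuous_subspaceT => t; apply: cvgMl_tmp.
  exact: (derivable1_continuous (is_derive1X 2 (is_derive_cos t))).
- split=> [t _||].
  + exact: (@ex_derive _ _ _ _ _ _ _ (dH t)).
  + by apply: cvg_at_right_filter; exact: (derivable1_continuous (dH _)).
  + by apply: cvg_at_left_filter; exact: (derivable1_continuous (dH _)).
- by move=> t _; rewrite derive1E (@derive_val _ _ _ _ _ _ _ (dH t)).
Qed.

Lemma disk_area rho : 0 <= rho -> mu2 (disk rho) = (pi * rho ^+ 2)%:E.
Proof.
rewrite le_eqVlt => /predU1P[<-|rho0].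
  rewrite expr0n/= mulr0 (_ : disk 0 = set0) ?measure0//.
  apply/seteqP; split=> z //; rewrite /disk/= expr0n/= ltNge.
  by rewrite addr_ge0 ?sqr_ge0.
rewrite -semicircle_integral//; apply: eq_integral => x _ /=.
rewrite xsectionE (_ : _ @^-1` _ =
  `](- Num.sqrt (rho ^+ 2 - x ^+ 2)), (Num.sqrt (rho ^+ 2 - x ^+ 2))[%classic); last first.
  apply/seteqP; split=> y /=; rewrite in_itv/= -ltr_norml /disk /= => h.
    rewrite -sqrtr_sqr ltr_sqrt; first lra.
    by have := sqr_ge0 y; lra.
  have s0 : 0 < Num.sqrt (rho ^+ 2 - x ^+ 2) by rewrite (le_lt_trans _ h).
  rewrite sqrtr_gt0 in s0; move: h; rewrite -sqrtr_sqr ltr_sqrt//; lra.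
rewrite lebesgue_measure_itv/= lte_fin; case: ifPn => [_|].
  by rewrite -EFinB; congr (_%:E); ring.
(* An empty section has radicand at most 0, where [Num.sqrt] is 0, so the length formula
   persists. *)
rewrite -leNgt => h; have s0 := sqrtr_ge0 (rho ^+ 2 - x ^+ 2).
by congr (_%:E); lra.
Qed.

Lemma qz_disk (s : R) : 0 <= s -> [set z | qz z < s] = disk (Num.sqrt (s / pi)).
Proof.
move=> s0; have p0 := pi_gt0 R.
rewrite /disk sqr_sqrtr ?divr_ge0 ?pi_ge0//.
by apply/seteqP; split=> z /=; rewrite /qz ltr_pdivlMr// mulrC.
Qed.

Lemma measurable_qz_lt (s : R) : measurable ([set z | qz z < s] : set (T * T)).
Proof.
have := measurable_fun_ltr measurable_qz (measurable_cst s).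
move=> /(_ measurableT [set true] I); rewrite setTI.
by congr (measurable _); apply/seteqP; split => z.
Qed.

Lemma qz_lt_measure (s : R) : 0 <= s -> mu2 [set z | qz z < s] = s%:E.
Proof.
move=> s0; rewrite qz_disk// disk_area ?sqrtr_ge0//.
rewrite sqr_sqrtr ?divr_ge0 ?pi_ge0// mulrC divfK//.
by rewrite gt_eqF// pi_gt0.
Qed.

End disk_area.

(** * Poisson weights integrated over an annulus *)

Section annulus.
Context {R : realType}.
Implicit Types (a b s t : R) (z : R * R) (n m : nat).

Local Notation T := (measurableTypeR R).
Local Notation mu2 := (leb2 R).

(** A weight is a difference of consecutive [poiscdf], so for [n > 0] its derivative is a difference
    of two numbers in [[0, 1]]. *)
Lemma is_derive_pois s n : exists2 d : R, is_derive s 1 (fun s => pois s n) d &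
  0 <= s -> `|d| <= 1.
Proof.
have p01 m : 0 <= s -> 0 <= pois s m <= 1.
  move=> s0; rewrite pois_ge0//=; have := pois_sum_le1 m.+1 s0.
  rewrite big_ord_recr/=; apply: le_trans; rewrite lerDr sumr_ge0// => i _.
  exact: pois_ge0.
case: n => [|n].
  exists (- pois s 0).
    have := is_derive_poiscdf s 0; congr is_derive.
    by apply/funext => u; rewrite /poiscdf big_ord1.
  by move=> /(p01 0)/andP[p0 p1]; rewrite normrN ger0_norm.
exists (- pois s n.+1 - - pois s n).
  have := is_derive1B (is_derive_poiscdf s n.+1) (is_derive_poiscdf s n); congr is_derive.
  by apply/funext => u; rewrite /poiscdf big_ord_recr/= addrAC subrr add0r.
by move=> s0; have := p01 n s0; have := p01 n.+1 s0; rewrite ler_norml; lra.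
Qed.

Lemma pois_lipschitz s t n : 0 <= s -> s <= t -> `|pois t n - pois s n| <= t - s.
Proof.
move=> s0; rewrite le_eqVlt => /predU1P[->|st]; first by rewrite !subrr normr0.
have D x : s <= x <= t -> is_derive x 1 (fun s => pois s n) ((fun s => pois s n)^`()%classic x).
  by move=> _; have [d D _] := is_derive_pois x n; rewrite derive1E derive_val.
have [c /andP[sc _] ->] := mean_value st D.
rewrite normrM [X in _ * X]ger0_norm ?subr_ge0 ?(ltW st)//.
rewrite ler_piMl ?subr_ge0 ?(ltW st)//.
have [d Dc] := is_derive_pois c n; rewrite derive1E derive_val; apply.
by rewrite (le_trans s0)// ltW.
Qed.

Lemma continuous_pois n : continuous (fun s : R => pois s n).
Proof. by move=> s; have [d D _] := is_derive_pois s n; exact: (derivable1_continuous D). Qed.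

Definition annulus a b : set (R * R) := [set z | qz z < b] `\` [set z | qz z < a].

Lemma annulusP a b z : annulus a b z <-> a <= qz z < b.
Proof.
rewrite /annulus/=; split=> [[h /negP]|/andP[h1 h2]]; first by rewrite -leNgt => ->.
by split=> //; apply/negP; rewrite -leNgt.
Qed.

Lemma measurable_annulus a b : measurable (annulus a b : set (T * T)).
Proof. by apply: measurableD; exact: measurable_qz_lt. Qed.

Lemma annulus_measure a b : 0 <= a -> a <= b -> mu2 (annulus a b) = (b - a)%:E.
Proof.
move=> a0 ab; have b0 := le_trans a0 ab.
rewrite /annulus measureD; [|exact: measurable_qz_lt..|].
  rewrite setIidr; last by move=> z /= /lt_le_trans; exact.
  exact: (congr2 (fun u v => u - v)%E (qz_lt_measure b0) (qz_lt_measure a0)).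
by rewrite [X in (X < _)%E](qz_lt_measure b0) ltry.
Qed.

Lemma annulus_integrable a b (f : T * T -> R) (M : R) : 0 <= a -> a <= b ->
  measurable_fun [set: T * T] f -> (forall z, annulus a b z -> `|f z| <= M) ->
  mu2.-integrable (annulus a b) (EFin \o f).
Proof.
move=> a0 ab mf fM; apply: measurable_bounded_integrable.
- exact: measurable_annulus.
- by rewrite /= -/(mu2 _) annulus_measure// ltry.
- exact: measurable_funTS.
- by exists M; split; [exact: num_real|move=> x Mx z /fM fz]; exact: le_trans fz (ltW Mx).
Qed.

Lemma qz_ge0 z : 0 <= qz z.
Proof. by rewrite mulr_ge0 ?pi_ge0// addr_ge0 ?sqr_ge0. Qed.

Lemma pois_le1 s n : 0 <= s -> pois s n <= 1.
Proof.
move=> s0; have := pois_sum_le1 n.+1 s0.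
rewrite big_ord_recr/=; apply: le_trans; rewrite lerDr sumr_ge0// => i _.
exact: pois_ge0.
Qed.

Lemma measurable_pois_qz n : measurable_fun [set: T * T] (fun z : T * T => pois (qz z) n : R).
Proof.
apply: (measurableT_comp (f := fun s : T => pois s n : R)); last exact: measurable_qz.
by apply: continuous_measurable_fun; exact: continuous_pois.
Qed.

Lemma pois_qz_integrable a b n : 0 <= a -> a <= b ->
  mu2.-integrable (annulus a b) (EFin \o (fun z => pois (qz z) n : R)).
Proof.
move=> a0 ab; apply: (@annulus_integrable _ _ _ 1) => //; first exact: measurable_pois_qz.
by move=> z _; rewrite ger0_norm ?pois_le1 ?pois_ge0 ?qz_ge0.
Qed.

Let J n a b := Rintegral mu2 (annulus a b) (fun z => pois (qz z) n).

(** Both quantities are [pois a n * (b - a)] up to [(b - a) ^+ 2]: the integral because the weight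
    is 1-Lipschitz in [qz] and the annulus has area [b - a], the difference of tails by the mean
    value theorem. *)
Let J_local n a b : 0 <= a -> a <= b ->
  `|J n a b - (poiscdf a n - poiscdf b n)| <= 2 * (b - a) ^+ 2.
Proof.
move=> a0 ab.
have mA := measurable_annulus a b.
have ic r : mu2.-integrable (annulus a b) (EFin \o (fun=> r : R)).
  by apply: (@annulus_integrable _ _ _ `|r|).
have ip := pois_qz_integrable n a0 ab.
have int_cst r : Rintegral mu2 (annulus a b) (fun=> r) = r * (b - a).
  by rewrite Rintegral_cst//= -/(mu2 _) annulus_measure.
have h1 : `|J n a b - pois a n * (b - a)| <= (b - a) ^+ 2.
  rewrite -int_cst -RintegralB//.
  have iB := integrableBr mA ip (ic (pois a n)).
  apply: le_trans (le_normr_Rintegral mA iB) _.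
  rewrite expr2 -int_cst; apply: le_Rintegral => //.
    exact: (integrable_norm iB).
  move=> z /annulusP /andP[az /ltW zb]; apply: le_trans (pois_lipschitz n a0 az) _.
  by rewrite lerB.
have h2 : `|pois a n * (b - a) - (poiscdf a n - poiscdf b n)| <= (b - a) ^+ 2.
  move: ab; rewrite le_eqVlt => /predU1P[->|ab]; first by rewrite !subrr mulr0 subrr normr0 expr0n.
  have [c /andP[ac cb] e] := mean_value ab (fun x _ => is_derive_poiscdf x n).
  have -> : pois a n * (b - a) - (poiscdf a n - poiscdf b n) =
     - ((pois c n - pois a n) * (b - a)) by lra.
  rewrite normrN normrM [X in _ * X]ger0_norm ?subr_ge0 ?(ltW ab)// expr2.
  rewrite ler_wpM2r ?subr_ge0 ?(ltW ab)// (le_trans (pois_lipschitz n a0 (ltW ac)))//.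
  by rewrite lerD2r ltW.
have -> : J n a b - (poiscdf a n - poiscdf b n) = J n a b - pois a n * (b - a) +
  (pois a n * (b - a) - (poiscdf a n - poiscdf b n)) by ring.
by apply: le_trans (ler_normD _ _) _; lra.
Qed.

Let J_cat n a b s : 0 <= a -> a <= s -> s <= b -> J n a b = J n a s + J n s b.
Proof.
move=> a0 as_ sb.
have e : annulus a b = annulus a s `|` annulus s b.
  apply/seteqP; split=> z.
    move=> /annulusP /andP[h1 h2]; case: (ltP (qz z) s) => h; [left|right]; apply/annulusP.
      by rewrite h1.
    by rewrite h.
  move=> [] /annulusP /andP[h1 h2]; apply/annulusP; apply/andP; split=> //.
    by rewrite (lt_le_trans h2).
  by rewrite (le_trans as_).
rewrite /J e; apply: Rintegral_setU; [exact: measurable_annulus..| |].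
  by rewrite -e; apply: pois_qz_integrable => //; exact: le_trans sb.
by apply/disj_setPS => z [] /annulusP /andP[_ h] /annulusP /andP[]; rewrite leNgt h.
Qed.

(** Over [N + 1] equal pieces the increments add up to at most [C (b - a) ^ 2 / (N + 1)]. *)
Lemma eq_of_quadratic_increments (f : R -> R) a b (C : R) : a <= b ->
  (forall s t, a <= s -> s <= t -> t <= b -> `|f t - f s| <= C * (t - s) ^+ 2) -> f b = f a.
Proof.
move=> ab h; apply/eqP; rewrite -subr_eq0 -normr_le0.
have bnd (N : nat) : `|f b - f a| <= C * (b - a) ^+ 2 / N.+1%:R.
  pose x (i : nat) := a + (b - a) * (i%:R / N.+1%:R).
  have x0 : x 0%N = a by rewrite /x mul0r mulr0 addr0.
  have xN : x N.+1 = b by rewrite /x divff ?pnatr_eq0// mulr1 subrKC.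
  have st i : x i.+1 - x i = (b - a) / N.+1%:R.
    by rewrite /x -natr1; field; rewrite nat1r pnatr_eq0.
  have ge0 i : 0 <= i%:R / N.+1%:R :> R by rewrite divr_ge0.
  have le1 i : (i <= N.+1)%N -> i%:R / N.+1%:R <= 1 :> R.
    by move=> iN; rewrite ler_pdivrMr ?mul1r ?ler_nat.
  have -> : f b - f a = \sum_(i < N.+1) (f (x i.+1) - f (x i)).
    by rewrite -(big_mkord xpredT (fun i => f (x i.+1) - f (x i))) telescope_sumr// x0 xN.
  apply: le_trans (ler_norm_sum _ _ _) _.
  apply: (@le_trans _ _ (\sum_(i < N.+1) C * ((b - a) / N.+1%:R) ^+ 2)).
    apply: ler_sum => i _; rewrite -(st i); apply: h.
    - by rewrite lerDl mulr_ge0 ?subr_ge0.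
    - by rewrite -subr_ge0 st divr_ge0 ?subr_ge0.
    - by rewrite -lerBrDl ler_piMr ?subr_ge0 ?le1// ltn_ord.
  rewrite sumr_const card_ord -[X in X <= _]mulr_natr le_eqVlt; apply/orP; left; apply/eqP.
  by rewrite -natr1; field; rewrite natr1 pnatr_eq0.
have lim : (fun N : nat => C * (b - a) ^+ 2 / N.+1%:R) @ \oo --> (0 : R).
  by rewrite -[X in _ --> X](mulr0 (C * (b - a) ^+ 2)); apply: cvgMl_tmp; exact: cvg_harmonic.
by apply: (cvgr_to_ge lim); near=> N; exact: bnd.
Unshelve. all: by end_near. Qed.

(* The pushforward of [leb2] by [qz] is the Lebesgue measure of the half-line;
   here this is used in differentiated form. *)
Lemma pois_qz_integral n a b : 0 <= a -> a <= b ->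
  Rintegral mu2 (annulus a b) (fun z => pois (qz z) n) = poiscdf a n - poiscdf b n.
Proof.
move=> a0 ab; apply/eqP; rewrite -subr_eq0; apply/eqP; rewrite -/(J n a b).
have -> : 0 = J n a a - (poiscdf a n - poiscdf a n).
  rewrite subrr subr0 /J (_ : annulus a a = set0) ?Rintegral_set0//.
  by apply/seteqP; split=> z // /annulusP /andP[h]; rewrite ltNge h.
apply: (@eq_of_quadratic_increments (fun s => J n a s - (poiscdf a n - poiscdf s n)) _ _ 2) => //.
move=> s t as_ st tb; rewrite (@J_cat n a t s)//.
have -> : J n a s + J n s t - (poiscdf a n - poiscdf t n) -
  (J n a s - (poiscdf a n - poiscdf s n)) = J n s t - (poiscdf s n - poiscdf t n) by ring.
by apply: J_local => //; exact: le_trans as_.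
Qed.

End annulus.

(** * Orthogonality of the transforms over an annulus *)

Section stft_orthogonality.
Context {R : realType}.
Implicit Types (a b s t : R) (z : R * R) (n m : nat).

Local Notation T := (measurableTypeR R).
Local Notation mu2 := (leb2 R).
Local Notation V := (stft (@gaussian R)).

Lemma cmeasurableM d (X : measurableType d) (D : set X) (f g : X -> R[i]) :
  cmeasurable D f -> cmeasurable D g -> cmeasurable D (fun x => f x * g x).
Proof.
move=> [fr fi] [gr gi]; split.
  rewrite (_ : (fun x => _) = fun x => complex.Re (f x) * complex.Re (g x) -
    complex.Im (f x) * complex.Im (g x)); last by apply/funext => x; rewrite cReM.
  by apply: measurable_funB; apply: measurable_funM.
rewrite (_ : (fun x => _) = fun x => complex.Re (f x) * complex.Im (g x) +
  complex.Im (f x) * complex.Re (g x)); last by apply/funext => x; rewrite cImM.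
by apply: measurable_funD; apply: measurable_funM.
Qed.

Lemma cmeasurableX d (X : measurableType d) (D : set X) (f : X -> R[i]) n :
  cmeasurable D f -> cmeasurable D (fun x => f x ^+ n).
Proof.
move=> mf; elim: n => [|n IH].
  rewrite (_ : (fun x => _) = fun=> 1); last by apply/funext => x; rewrite expr0.
  by split; exact: measurable_cst.
rewrite (_ : (fun x => _) = fun x => f x * f x ^+ n); first exact: cmeasurableM.
by apply/funext => x; rewrite exprS.
Qed.

Lemma cis_exp t n : cis t ^+ n = cis (n%:R * t).
Proof.
elim: n => [|n IH]; first by rewrite mul0r /cis cos0 sin0.
by rewrite exprS IH -nat1r mulrDl mul1r; apply: complexP; rewrite /= ?cosD ?sinD; ring.
Qed.

Lemma conj_mulJ (u v : R[i]) : (u * v^*)^* = v * u^*.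
Proof. by case: u => ? ?; case: v => ? ?; apply: complexP => /=; ring. Qed.

Let F n m z := V (hfun n) z * (V (hfun m) z)^*.

Lemma stft_hfun_mulJ_measurable n m :
  cmeasurable (setT : set (T * T)) (fun z => V (hfun n) z * (V (hfun m) z)^*).
Proof.
have -> := funext (stft_hfun_mulJ n m).
apply: cmeasurableM.
  split; last exact: measurable_cst.
  apply: measurable_funM; first exact: measurable_cst.
  apply: measurableT_comp; first exact: measurable_expR.
  by apply: measurable_funN; exact: measurable_qz.
apply: cmeasurableM; apply: cmeasurableX; split=> /=.
- exact: measurable_fst.
- by apply: measurable_funN; exact: measurable_snd.
- exact: measurable_fst.
- exact: measurable_snd.
Qed.

Lemma sqc_stft_hfun_mulJ_le1 n m z : sqc (V (hfun n) z * (V (hfun m) z)^*) <= 1.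
Proof.
rewrite sqcM sqcJ !sqc_stft_hfun.
by rewrite mulr_ile1 ?pois_ge0 ?pois_le1 ?qz_ge0.
Qed.

Lemma stft_hfun_mulJ_integrable a b n m : 0 <= a -> a <= b ->
  cintegrable mu2 (annulus a b) (fun z => V (hfun n) z * (V (hfun m) z)^*).
Proof.
move=> a0 ab; have [mr mi] := stft_hfun_mulJ_measurable n m.
by split; apply: (@annulus_integrable _ _ _ _ 1) => // z _;
  [apply: ler_Re_sqc|apply: ler_Im_sqc] => //; rewrite expr1n sqc_stft_hfun_mulJ_le1.
Qed.

Let qz_rotation t z : qz (rotation (cos t) (sin t) z) = qz z.
Proof.
rewrite /qz /rotation /=; congr (_ * _).
have := cos2Dsin2 t => e.
by rewrite -[RHS]mul1r -[in RHS]e; ring.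
Qed.

Let F_rotation t n m z : (n <= m)%N ->
  F n m (rotation (cos t) (sin t) z) = cis ((m - n)%:R * t) * F n m z.
Proof.
move=> nm; set w := rotation _ _ z.
have q : qz w = qz z by exact: qz_rotation.
rewrite [F n m w](stft_hfun_mulJ n m w) [F n m z](stft_hfun_mulJ n m z) q.
have -> : w.1 +i* w.2 = cis t * (z.1 +i* z.2).
  by apply: complexP; rewrite /=; ring.
have -> : w.1 +i* - w.2 = (cis t)^* * (z.1 +i* - z.2).
  by apply: complexP; rewrite /=; ring.
have e : (cis t)^* ^+ n * cis t ^+ m = cis ((m - n)%:R * t) :> R[i].
  rewrite -{1}(subnKC nm) exprD mulrA -exprMn [(cis t)^* * _]mulrC mulcJ.
  rewrite (_ : sqc _ = 1) ?expr1n ?mul1r ?cis_exp//.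
  exact: cos2Dsin2.
by rewrite !exprMn -e; ring.
Qed.

(** Rotation by [t] preserves measure and annulus and multiplies the integrand by [cis ((m - n) t)].
    The chosen [t] makes this factor ['i], and [I = 'i * I] forces [I = 0]; moreover [0 < t < pi],
    so [sin t] is nonzero as the factorisation into shears requires. *)
Let offdiag a b n m : 0 <= a -> a <= b -> (n < m)%N ->
  cintegral mu2 (annulus a b) (F n m) = 0.
Proof.
move=> a0 ab nm; pose t : R := pi / 2 / (m - n)%:R.
have d0 : (m - n)%:R != 0 :> R by rewrite pnatr_eq0 subn_eq0 -ltnNge.
have d1 : 1 <= (m - n)%:R :> R by rewrite ler1n subn_gt0.
have pi0 := pi_gt0 R.
have st0 : sin t != 0.
  rewrite gt_eqF// sin_gt0_pi//; apply/andP; split.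
    by rewrite /t !divr_gt0// (lt_le_trans ltr01).
  rewrite /t ltr_pdivrMr ?(lt_le_trans ltr01)//.
  by apply: (@lt_le_trans _ _ pi); [lra|rewrite ler_peMr ?(ltW pi0)].
have mp := rotation_preserving (cos2Dsin2 t) st0.
have FE z : F n m (rotation (cos t) (sin t) z) = 'i * F n m z.
  rewrite F_rotation ?(ltnW nm)//; congr (_ * _).
  rewrite /t (_ : _ * _ = pi / 2); last by rewrite mulrC divfK.
  by rewrite /cis cos_pihalf sin_pihalf.
have preA : rotation (cos t) (sin t) @^-1` annulus a b = annulus a b.
  by apply/seteqP; split=> z /annulusP; [rewrite qz_rotation|rewrite -(qz_rotation t)]; move/annulusP.
have [mr mi] := stft_hfun_mulJ_measurable n m.
have mA := measurable_annulus a b.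
have iF := stft_hfun_mulJ_integrable n m a0 ab.
have [ir ii] := iF; have [iir iii] := cintegrableZ mA 'i iF.
have key : cintegral mu2 (annulus a b) (F n m) = 'i * cintegral mu2 (annulus a b) (F n m).
  rewrite -cintegralZ//; apply: complexP.
    have h := Rintegral_measure_preserving mp mA mr; rewrite preA in h.
    rewrite [LHS]/= -h; first by apply: eq_Rintegral => z _; exact: congr1 _ (FE z).
    move: iir; congr (_.-integrable _ _); apply/funext => z.
    by rewrite fctE -(FE z).
  have h := Rintegral_measure_preserving mp mA mi; rewrite preA in h.
  rewrite [LHS]/= -h; first by apply: eq_Rintegral => z _; exact: congr1 _ (FE z).
  move: iii; congr (_.-integrable _ _); apply/funext => z.
  by rewrite fctE -(FE z).
case: (cintegral _ _ _) key => u v [] e1 e2.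
by apply: complexP => /=; lra.
Qed.

Lemma stft_hfun_orthogonal a b n m : 0 <= a -> a <= b ->
  cintegral mu2 (annulus a b) (fun z => V (hfun n) z * (V (hfun m) z)^*) =
  (n == m)%:R * (poiscdf a m - poiscdf b m)%:C.
Proof.
move=> a0 ab; case: (ltngtP n m) => [nm|mn|->]; rewrite ?mul0r ?mul1r.
- exact: offdiag.
- rewrite -[RHS](rmorph0 (Num.conj)) -(offdiag a0 ab mn).
  have mA := measurable_annulus a b.
  apply: etrans (cintegralJ mA (stft_hfun_mulJ_integrable m n a0 ab)).
  by apply: eq_cintegral => z _; rewrite conj_mulJ.
- have e z : V (hfun m) z * (V (hfun m) z)^* = (pois (qz z) m)%:C.
    by rewrite mulcJ sqc_stft_hfun.
  rewrite (funext e) -pois_qz_integral//; apply: complexP => //=.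
  by rewrite Rintegral_cst ?mul0r//; exact: measurable_annulus.
Qed.

End stft_orthogonality.

(** * Termwise integration over a set of finite measure *)

Section bounded_convergence.
Context d (T : measurableType d) (R : realType).
Variables (mu : {measure set T -> \bar R}) (D : set T).
Hypotheses (mD : measurable D) (Dfin : (mu D < +oo)%E).

Lemma bounded_convergence (u : nat -> T -> R) (g : T -> R) (M : R) :
  (forall N, measurable_fun D (u N)) ->
  (forall x, D x -> u N x @[N --> \oo] --> g x) ->
  (forall N x, D x -> `|u N x| <= M) ->
  mu.-integrable D (EFin \o g) /\
  Rintegral mu D (u N) @[N --> \oo] --> Rintegral mu D g.
Proof.
move=> mu_ ug uM.
have mg : measurable_fun D g by exact: measurable_fun_cvg mu_ ug.
have icst : mu.-integrable D (EFin \o (fun=> M : R)).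
  apply: measurable_bounded_integrable => //.
  by exists `|M|; split; [exact: num_real|move=> x Mx z _; exact: ltW].
have [] := @dominated_convergence _ T R mu D mD (fun N => EFin \o u N) (EFin \o g) (EFin \o (fun=> M)).
- by move=> N; exact/measurable_EFinP.
- exact/measurable_EFinP.
- by apply: aeW => x Dx /=; apply: cvg_EFin; [exact: nearW|exact: ug].
- exact: icst.
- by apply: aeW => x N Dx /=; rewrite lee_fin; exact: uM.
move=> ig _ lim; split=> //.
have := fine_cvg (_ : _ --> (Rintegral mu D g)%:E).
apply.
rewrite /Rintegral fineK//; exact: integrable_fin_num.
Qed.

(** The limit is taken in real and imaginary parts separately. The integrals of the approximants are
    eventually constant, so their common value is the integral of the limit. *)
Lemma complex_bounded_convergence (u : nat -> T -> R[i]) (g : T -> R[i])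
    (e : nat -> T -> R) (M : R) (l : R[i]) :
  (forall N, cintegrable mu D (u N)) ->
  (forall N z, D z -> sqc (g z - u N z) <= e N z ^+ 2) ->
  (forall z, D z -> e N z @[N --> \oo] --> 0) ->
  (forall N z, D z -> 0 <= e N z <= M) ->
  (forall z, D z -> sqc (g z) <= M ^+ 2) ->
  (\forall N \near \oo, cintegral mu D (u N) = l) ->
  cintegrable mu D g /\ cintegral mu D g = l.
Proof.
move=> iu ue e0 eM gM ul.
have part (P : R[i] -> R) : (forall v w, P (v - w) = P v - P w) ->
    (forall v (c : R), 0 <= c -> sqc v <= c ^+ 2 -> `|P v| <= c) ->
    (forall N, mu.-integrable D (EFin \o (fun z => P (u N z)))) ->
    mu.-integrable D (EFin \o (fun z => P (g z))) /\
    Rintegral mu D (fun z => P (u N z)) @[N --> \oo] --> Rintegral mu D (fun z => P (g z)).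
  move=> PB Pb iP.
  have dist N z : D z -> `|P (g z) - P (u N z)| <= e N z.
    by move=> Dz; rewrite -PB; apply: Pb; [case/andP: (eM N z Dz)|exact: ue].
  apply: (@bounded_convergence (fun N z => P (u N z)) (fun z => P (g z)) (M + M)).
  - move=> N; apply/measurable_EFinP; exact: measurable_int (iP N).
  - move=> z Dz; apply/cvgrPdist_le => c c0.
    have /cvgrPdist_le/(_ c c0) := e0 z Dz.
    apply: filterS => N; rewrite sub0r normrN => h.
    by apply: le_trans (dist N z Dz) (le_trans (ler_norm _) h).
  - move=> N z Dz; have /andP[e1 e2] := eM N z Dz.
    have M0 := le_trans e1 e2.
    have := dist N z Dz; have := Pb _ _ M0 (gM z Dz).
    by rewrite !ler_norml; lra.
have reB (v w : R[i]) : complex.Re (v - w) = complex.Re v - complex.Re w.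
  by case: v; case: w.
have imB (v w : R[i]) : complex.Im (v - w) = complex.Im v - complex.Im w.
  by case: v; case: w.
have [ir lr] := part (@complex.Re R) reB (@ler_Re_sqc R) (fun N => (iu N).1).
have [ii li] := part (@complex.Im R) imB (@ler_Im_sqc R) (fun N => (iu N).2).
split=> //; apply: complexP => /=.
  apply: (cvg_unique _ lr) => //; apply: cvg_near_cst.
  by apply: filterS ul => N /(congr1 (@complex.Re R)).
apply: (cvg_unique _ li) => //; apply: cvg_near_cst.
by apply: filterS ul => N /(congr1 (@complex.Im R)).
Qed.

End bounded_convergence.

Section stft_annulus.
Context {R : realType}.
Implicit Types (a b : R) (z : R * R) (n m N : nat) (f : R -> R[i]).

Local Notation T := (measurableTypeR R).
Local Notation mu2 := (leb2 R).
Local Notation V := (stft (@gaussian R)).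

Lemma annulus_measure_fin a b : 0 <= a -> a <= b -> (mu2 (annulus a b) < +oo)%E.
Proof. by move=> a0 ab; rewrite annulus_measure// ltry. Qed.

Lemma sqc_stft_le f z : L2 f -> sqc (V f z) <= normsq f.
Proof.
by move=> f2; have := stft_expansion z 0 f2; rewrite !big_ord0 !subr0 mulr1.
Qed.

(** The Hermite functions diagonalise the operator weakly. [V f] is replaced by its truncated
    Hermite expansion: by orthogonality the truncated integral is exact once [N > m], and [e N] is
    the pointwise error from [stft_expansion]. *)
Lemma stft_annulus f m a b : L2 f -> 0 <= a -> a <= b ->
  cintegrable mu2 (annulus a b) (fun z => V f z * (V (hfun m) z)^*) /\
  cintegral mu2 (annulus a b) (fun z => V f z * (V (hfun m) z)^*) =
  inner f (hfun m) * (poiscdf a m - poiscdf b m)%:C.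
Proof.
move=> f2 a0 ab; have mA := measurable_annulus a b.
pose c i := inner f (hfun i).
pose F i z := V (hfun i) z * (V (hfun m) z)^*.
pose u N z := \sum_(i < N) c i * F i z.
have iF i : cintegrable mu2 (annulus a b) (F i) by exact: stft_hfun_mulJ_integrable.
pose e N z := Num.sqrt (normsq f * (1 - \sum_(i < N) pois (qz z) i)).
have s1 N z : 0 <= 1 - \sum_(i < N) pois (qz z) i <= 1.
  rewrite subr_ge0 pois_sum_le1 ?qz_ge0//= lerBlDr lerDl.
  by apply: sumr_ge0 => i _; rewrite pois_ge0// qz_ge0.
have r0 N z : 0 <= normsq f * (1 - \sum_(i < N) pois (qz z) i).
  by rewrite mulr_ge0 ?normsq_ge0//; case/andP: (s1 N z).
have Vm z : sqc (V (hfun m) z) <= 1 by rewrite sqc_stft_hfun pois_le1// qz_ge0.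
apply: (@complex_bounded_convergence _ _ _ _ _ mA (annulus_measure_fin a0 ab) u _ e (Num.sqrt (normsq f))).
- by move=> N; apply: cintegrable_sum => // i; apply: cintegrableZ => //; exact: iF.
- move=> N z _; rewrite sqr_sqrtr//.
  have -> : V f z * (V (hfun m) z)^* - u N z =
      (V f z - \sum_(i < N) c i * V (hfun i) z) * (V (hfun m) z)^*.
    rewrite mulrBl mulr_suml; congr (_ - _); apply: eq_bigr => i _.
    by rewrite /F mulrA.
  rewrite sqcM sqcJ; apply: le_trans (stft_expansion z N f2).
  by rewrite ler_piMr ?sqc_ge0.
- move=> z _.
  have lim : normsq f * (1 - \sum_(i < N) pois (qz z) i) @[N --> \oo] --> (0 : R).
    rewrite -[X in _ --> X](mulr0 (normsq f)); apply: cvgMl_tmp.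
    rewrite -[X in _ --> X](subrr 1); apply: cvgB; first exact: cvg_cst.
    exact: pois_sum_cvg.
  rewrite -[X in _ --> X](@sqrtr0 R).
  by apply: continuous_cvg lim; exact: sqrt_continuous.
- move=> N z _; rewrite sqrtr_ge0/= ler_sqrt ?normsq_ge0//.
  by rewrite ler_piMr ?normsq_ge0//; case/andP: (s1 N z).
- move=> z _; rewrite sqr_sqrtr ?normsq_ge0// sqcM sqcJ.
  by apply: le_trans (sqc_stft_le z f2); rewrite ler_piMr ?sqc_ge0.
exists m.+1 => // N mN.
rewrite cintegral_sum//; last by move=> i; apply: cintegrableZ => //; exact: iF.
rewrite (bigD1 (Ordinal mN))//= big1 ?addr0 => [|i im].
  by rewrite [LHS](cintegralZ mA (c m) (iF m)) stft_hfun_orthogonal// eqxx mul1r.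
rewrite [LHS](cintegralZ mA (c i) (iF i)).
rewrite stft_hfun_orthogonal// (_ : (i == m :> nat) = false) ?mul0r ?mulr0//.
by apply: contraNF im => /eqP e'; apply/eqP/val_inj.
Qed.

End stft_annulus.

(** * Eigenspaces of the localization operator *)

Section annulus_spectrum.
Context {R : realType}.
Variables a b : R.
Hypotheses (a0 : 0 <= a) (ab : a <= b).
Implicit Types (f h phi : R -> R[i]) (z : R * R) (n m k : nat).

Local Notation T := (measurableTypeR R).
Local Notation mu2 := (leb2 R).
Local Notation V := (stft (@gaussian R)).
Local Notation A := (locop (@gaussian R) (annulus a b)).

Definition annulus_ev n : R := poiscdf a n - poiscdf b n.

Lemma ev_cvg0 : annulus_ev n @[n --> \oo] --> (0 : R).
Proof.
have cdf1 s : poiscdf s n @[n --> \oo] --> (1 : R).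
  exact: cvg_comp (cvg_addnl 1%N) (@pois_sum_cvg _ s).
by rewrite -[X in _ --> X](subrr 1); apply: cvgB; exact: cdf1.
Qed.

(** Both distribution functions tend to 1, so the eigenvalues tend to 0. Finiteness of the level set
    supplies the dimension at which the listing is consulted. *)
Lemma finite_ev (m : R) : 0 < m -> finite_set [set n | annulus_ev n = m].
Proof.
move=> m0; have [N _ h] := cvgr_lt 0 ev_cvg0 m m0.
apply: (sub_finite_set _ (finite_II N)) => n /= e.
by rewrite ltnNge; apply/negP => /h /=; rewrite e ltxx.
Qed.

Let inner_tfshift phi z : L2 phi -> inner (tfshift z (@gaussian R)) phi = (V phi z)^*.
Proof. by move=> p2; exact: (innerC p2 (coherent_L2 z)). Qed.

Let locop_rhs f phi : L2 phi ->
  cintegral mu2 (annulus a b) (fun z => V f z * inner (tfshift z (@gaussian R)) phi) =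
  cintegral mu2 (annulus a b) (fun z => V f z * (V phi z)^*).
Proof. by move=> p2; apply: eq_cintegral => z _; rewrite inner_tfshift. Qed.

(** [stft_annulus] has [hfun n] on the conjugate side; applied to the test function [phi] and
    conjugated, it gives the weak identity. *)
Lemma locop_hfun n : A (hfun n) (fun t => (annulus_ev n)%:C * hfun n t).
Proof.
have h2 : L2 (hfun n : R -> R[i]) := hfun_L2 n; split=> //; first exact: L2Z.
move=> phi p2; rewrite locop_rhs//.
have [iV eV] := stft_annulus n p2 a0 ab.
have mA := measurable_annulus a b.
transitivity (cintegral mu2 (annulus a b) (fun z => V phi z * (V (hfun n) z)^*))^*.
  rewrite eV -/(annulus_ev n) (innerZl _ h2 p2) (innerC p2 h2) mulrC.
  by rewrite -[(annulus_ev n)%:C in LHS]conj_real; symmetry; exact: rmorphM.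
apply: etrans (esym (cintegralJ mA iV)) _.
by apply: eq_cintegral => z _; rewrite conj_mulJ.
Qed.

Lemma locop_inner_hfun f (m : R) n : A f (fun t => m%:C * f t) ->
  m%:C * inner f (hfun n) = inner f (hfun n) * (annulus_ev n)%:C.
Proof.
move=> [f2 _ /(_ _ (hfun_L2 n))]; rewrite locop_rhs; last exact: hfun_L2.
have [_ ->] := stft_annulus n f2 a0 ab.
by rewrite innerZl//; exact: hfun_L2.
Qed.

(** By [locop_inner_hfun] an eigenfunction has nonzero coefficients only at indices with
    [annulus_ev n = m], so spanning amounts to showing that the residual [f'] is null. *)
Lemma has_dim_eigenspace (m : R) k : 0 < m ->
  ([set n | annulus_ev n = m] #= `I_k)%card -> has_dim (eigenspace_of A m%:C) k.
Proof.
move=> m0 /card_esym /card_set_bijP [s [s_to s_inj s_surj]].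
pose bs (i : 'I_k) : R -> R[i] := hfun (s i).
have bs2 i : L2 (bs i) by exact: hfun_L2.
have evs (i : 'I_k) : annulus_ev (s i) = m by exact: (s_to i (ltn_ord i)).
have sI (i j : 'I_k) : (s i == s j) = (i == j).
  apply/eqP/eqP => [e|->//]; apply: val_inj; apply: s_inj => //; rewrite inE /=; exact: ltn_ord.
have coef (c : 'I_k -> R[i]) i : inner (lincomb c bs) (bs i) = c i.
  rewrite inner_lincombl// (bigD1 i)//= hfun_orthonormal eqxx mulr1 big1 ?addr0// => j ji.
  by rewrite hfun_orthonormal sI (negbTE ji) mulr0.
exists bs; split.
- move=> i; split; first exact: hfun_L2.
  by rewrite -(evs i); exact: locop_hfun.
- move=> c c0 i; rewrite -(coef c i); apply: inner_ae0 => //; exact: L2_lincomb.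
move=> f [f2 Af]; pose c i := inner f (bs i); exists c.
have S2 : L2 (lincomb c bs) by exact: L2_lincomb.
have nS2 : L2 (fun t => -1 * lincomb c bs t) by exact: L2Z.
pose f' t := f t + -1 * lincomb c bs t.
have f'2 : L2 f' by exact: L2D.
have orth n : inner f' (hfun n) = 0.
  have h2 : L2 (hfun n : R -> R[i]) := hfun_L2 n; rewrite innerDl// innerZl// mulN1r.
  have [en|en] := eqVneq (annulus_ev n) m.
    have [i ik <-] := s_surj n en.
    by rewrite -[hfun _]/(bs (Ordinal ik)) coef /c subrr.
  have -> : inner f (hfun n) = 0.
    have /eqP := locop_inner_hfun n Af; rewrite mulrC -subr_eq0 -mulrBr mulf_eq0 => /orP[/eqP//|].
    by rewrite -rmorphB => /eqP [] /eqP; rewrite subr_eq0 eq_sym (negbTE en).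
  rewrite inner_lincombl// big1 ?subrr// => i _.
  rewrite hfun_orthonormal (_ : (s i == n) = false) ?mulr0//.
  by apply: contraNF en => /eqP <-; rewrite evs.
(* The eigenvalue equation tested on [f'], whose transform vanishes, gives [m * inner f f' = 0] with
   [m > 0]. As [f'] is also orthogonal to the combination subtracted from [f], its norm is 0. *)
have ff' : inner f f' = 0.
  have [_ _ /(_ _ f'2)] := Af; rewrite locop_rhs// innerZl//.
  rewrite (_ : cintegral _ _ _ = 0).
    by move=> /eqP; rewrite mulf_eq0 => /orP[/eqP[e]|/eqP//]; rewrite e ltxx in m0.
  apply: (etrans _ (cintegral0 mu2 (measurable_annulus a b))); apply: eq_cintegral => z _.
  by rewrite (stft_eq0 z f'2 orth) rmorph0 mulr0.
have n0 : normsq f' = 0.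
  have := inner_self f'; rewrite {1}/f' innerDl// ff' innerZl// inner_lincombl// big1.
    by rewrite mulr0 addr0 => -[].
  by move=> i _; rewrite (innerC f'2 (bs2 i)) orth rmorph0 mulr0.
move: (normsq_eq0 f'2 n0) => [N [mN N0 sub]]; exists N; split=> // t /= nt.
apply: sub => /= ft; apply: nt => _; apply/eqP; rewrite -subr_eq0 -mulN1r.
by apply/eqP; exact: (ft I).
Qed.

Lemma listing_same_mult (lam : nat -> R) (m : R) : eigenvalue_listing A lam -> 0 < m ->
  ([set n | annulus_ev n = m] #= [set k | (1 <= k)%N /\ lam k = m])%card.
Proof.
move=> [_ _ h] m0; have [k ek] := finite_ev m0.
have /(h _ _ m0) ek' := has_dim_eigenspace m0 ek.
exact: card_eq_trans ek (card_esym ek').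
Qed.

End annulus_spectrum.

Theorem proposition2p4 (R : realType) (r : R) (hr0 : 0 < r) (hr1 : r < 1) :
  exists C rho0 : R, 0 < C /\ 0 < rho0 /\
    forall rho : R, rho0 <= rho ->
    forall lam : nat -> R,
      eigenvalue_listing
        (locop (@gaussian R) (disk rho `\` disk (r * rho))) lam ->
    forall k : nat, (1 <= k)%N ->
      `| lam k - 2^-1 * erfc ((k%:R - pi * rho ^+ 2 * (1 - r ^+ 2)) /
                              (Num.sqrt (2 * pi) * rho * (1 + r))) |
      <= C / rho.
Proof.
have pi0 := pi_gt0 R; have pi1 : 1 <= pi :> R by have := pi_ge2 R; lra.
have [B B0 berry] := @pois_berry_esseen R.
pose p : R := Num.sqrt pi.
have p0 : 0 < p by rewrite sqrtr_gt0.
have pp : p ^+ 2 = pi by rewrite sqr_sqrtr// ltW.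
have r1 : 0 < 1 - r by lra.
(* With [sqrt a = p r rho] and [sqrt b - sqrt a = p (1 - r) rho], this is the bound of
   [annulus_estimate] multiplied by [rho]. The threshold [1 / r] ensures [r rho >= 1], hence
   [a >= pi >= 1]. *)
exists ((3 * B + 4) / (p * r) + (p * (1 - r))^-1), r^-1; split.
  by rewrite addr_gt0// ?invr_gt0 ?divr_gt0 ?mulr_gt0//; lra.
split; first by rewrite invr_gt0.
move=> rho hrho lam lamP k k1.
have rho0 : 0 < rho by apply: lt_le_trans hrho; rewrite invr_gt0.
have rrho : 1 <= r * rho by rewrite mulrC -ler_pdivrMr// mul1r.
pose a : R := (p * (r * rho)) ^+ 2; pose b : R := (p * rho) ^+ 2.
have sa : Num.sqrt a = p * (r * rho) by rewrite sqrtr_sqr ger0_norm// ?mulr_ge0// ltW.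
have sb : Num.sqrt b = p * rho by rewrite sqrtr_sqr ger0_norm// ?mulr_ge0// ltW.
have a1 : 1 <= a by rewrite /a exprMn pp mulr_ege1// exprn_ege1.
have ab : a < b.
  rewrite /a /b ltr_pXn2r ?nnegrE ?mulr_ge0 ?(ltW p0) ?(ltW rho0) ?(ltW hr0)//.
  by rewrite ltr_pM2l// gtr_pMl.
have a0 : 0 <= a by exact: sqr_ge0.
have b0 : 0 <= b by exact: sqr_ge0.
have qd (s : R) : 0 <= s -> [set z | qz z < (p * s) ^+ 2] = disk s.
  move=> s0; rewrite qz_disk ?sqr_ge0// exprMn pp [pi * _]mulrC mulfK ?gt_eqF//.
  by rewrite sqrtr_sqr ger0_norm.
have E : disk rho `\` disk (r * rho) = annulus a b.
  by rewrite /annulus !qd// ?mulr_ge0// ltW.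
rewrite E in lamP.
have [l1 l2 _] := lamP.
have := annulus_estimate B0 a1 ab (fun x n => berry x n) l1 l2
  (fun m m0 => listing_same_mult a0 (ltW ab) lamP m0) k1.
rewrite sa sb /ncdf.
have -> : Num.sqrt (2 * pi) = Num.sqrt 2 * p :> R by rewrite sqrtrM.
(* [ncdf] is half of [erfc] at the opposite argument, which reverses the sign; [b - a] is the area
   of the annulus. *)
rewrite (_ : - ((b - a - k%:R) / _) = (k%:R - pi * rho ^+ 2 * (1 - r ^+ 2)) /
  (Num.sqrt 2 * p * rho * (1 + r))); last first.
  have -> : pi * rho ^+ 2 * (1 - r ^+ 2) = b - a by rewrite /a /b -pp; ring.
  rewrite -mulNr opprB; congr (_ / _); ring.
move=> /le_trans; apply; rewrite le_eqVlt; apply/orP; left; apply/eqP.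
have n1 : p * rho - p * (r * rho) = p * (1 - r) * rho by ring.
rewrite n1; field; rewrite !gt_eqF//=.
Qed.
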